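(* Let $(M,g)$ be a connected closed oriented Riemannian $4$-manifold. For a smooth real-valued function $\omega$ on $M$, let $h:=e^{2\omega}\operatorname{Id}$, where $\operatorname{Id}$ is the identity endomorphism of $\Lambda_g^+$, and let $\hat g:=e^{2\omega}g$. Then the positive endomorphism $h$ of $\Lambda_g^+$ solves the equation $\Phi_g(h)=0$ if and only if the metric $\hat g$ is anti-self-dual and has constant scalar curvature $6\sqrt{2}$.
   Context: Everything is smooth. A metric $\hat g$ is anti-self-dual if its self-dual Weyl curvature $W^+_{\hat g}$ (the trace-free self-adjoint endomorphism of the bundle of self-dual $2$-forms given by the Weyl curvature) vanishes. Curvature sign: $R(X,Y)Z=\nabla_X\nabla_YZ-\nabla_Y\nabla_XZ-\nabla_{[X,Y]}Z$, so that round spheres have positive curvature. $\Lambda^k=\bigwedge^kT^*M$; $\Omega^k(\mathcal{E})$ is the space of smooth $\mathcal{E}$-valued $k$-forms; $\star$ is the Hodge star of $g$, acting on the ordinary form factor of bundle-valued forms; $T^\pm=\frac12(T\pm\star T)$ for a bundle-valued $2$-form $T$. The bundle $\Lambda^+=\Lambda^+_g\subset\Lambda^2$ of self-dual $2$-forms ($\star\sigma=\sigma$) has rank three and carries the Euclidean metric induced by $g$ (for an orthonormal co-frame, the $\theta_a\wedge\theta_b$, $a<b$, are orthonormal in $\Lambda^2$). It is oriented by declaring positive the local orthonormal frame $\Sigma_i=-(\theta_0\wedge\theta_i+\theta_j\wedge\theta_k)/\sqrt2$, $(i,j,k)$ a cyclic permutation of $(1,2,3)$, where $(\theta_0,\theta_1,\theta_2,\theta_3)$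 is a local oriented $g$-orthonormal co-frame. $[-,-]$ denotes the fibrewise cross product on $\Lambda^+$ ($[\Sigma_i,\Sigma_j]=\sum_k\epsilon_{ijk}\Sigma_k$), and $\mathfrak{so}(\Lambda^+)$ is identified with $\Lambda^+$ by letting $f$ correspond to $v\mapsto[f,v]$. For $\Lambda^+$-valued forms, $[\sum\alpha_i\otimes\Sigma_i,\sum\beta_j\otimes\Sigma_j]=\sum_{i,j}\alpha_i\wedge\beta_j\otimes[\Sigma_i,\Sigma_j]$. An $\operatorname{SO}(3)$ connection $A$ on $\Lambda^+$ is a metric connection, with exterior covariant derivative $d_A$ and curvature $F_A\in\Omega^2(\Lambda^+)$ (via $\mathfrak{so}(\Lambda^+)\cong\Lambda^+$), so $d_A^2\alpha=[F_A,\alpha]$; for $a\in\Omega^1(\Lambda^+)$, $\nabla^{A+a}v=\nabla^Av+[a,v]$. A $\Lambda^+$-valued self-dual $2$-form $T=\sum_{i,j}T_{ji}\Sigma_j\otimes\Sigma_i$ (first factor: ordinary form; second: coefficient) is regarded as the endomorphism $v\mapsto\sum_{i,j}T_{ji}\langle\Sigma_i,v\rangle\Sigma_j$ of $\Lambda^+$. $\operatorname{Sym}^2(\Lambda^+)$ is the bundle of self-adjoint endomorphisms of $\Lambda^+$, and $\Omega^0_+(\operatorname{Sym}^2(\Lambda^+))$ is the set of its smooth sections $h$ with $h>0$ (positive definite at every point). For an endomorphism field $h$ of $\Lambda^+$, $B_h\in\Omega^2(\Lambda^+)$ is given locally by $B_h=\sum_ih(\Sigma_i)\otimes\Sigma_i$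 (first factor: ordinary $2$-form; second: coefficient), for any local oriented orthonormal frame. For $h\in\Omega^0_+(\operatorname{Sym}^2(\Lambda^+))$, $\operatorname{ad}_h\colon\Omega^1(\Lambda^+)\to\Omega^3(\Lambda^+)$, $\operatorname{ad}_h(a)=[a,B_h]$, is invertible, and $A(h):=\Gamma-\operatorname{ad}_h^{-1}(d_\Gamma B_h)$, where $\Gamma$ is the connection on $\Lambda^+$ induced by the Levi--Civita connection of $g$. Then $\Phi_g(h):=F_{A(h)}^+h^{-1}-\operatorname{Id}$ (composition of endomorphisms), a section of $\operatorname{Sym}^2(\Lambda^+)$. *)

(* Defs.v *)
From HB Require Import structures.
From mathcomp Require Import all_boot all_order all_algebra.
From mathcomp Require Import all_classical all_reals all_analysis.

Set Implicit Arguments.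
Unset Strict Implicit.
Unset Printing Implicit Defensive.
Import Order.TTheory GRing.Theory Num.Theory.
Import numFieldNormedType.Exports.
Local Open Scope classical_set_scope.
Local Open Scope ring_scope.

Section smooth.
Variable R : realType.

Definition pderiv (V : normedModType R) (m : 'I_4) (f : 'rV[R]_4 -> V) :
  'rV[R]_4 -> V := fun x => 'D_(delta_mx 0 m) f x.

(* Meaningful for open U; f may take arbitrary values outside U. *)
Fixpoint Ck (V : normedModType R) (k : nat) (U : set 'rV[R]_4)
    (f : 'rV[R]_4 -> V) : Prop :=
  (forall x, U x -> {for x, continuous f}) /\
  if k is k'.+1 then
    forall m, (forall x, U x -> derivable f x (delta_mx 0 m)) /\
              Ck k' U (pderiv m f)
  else True.

Definition smooth (V : normedModType R) (U : set 'rV[R]_4)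
  (f : 'rV[R]_4 -> V) : Prop := forall k, Ck k U f.

End smooth.

(* An oriented smooth structure is given by an oriented smooth atlas, which
   need not be maximal. *)
Record oriented_atlas (R : realType) (M : topologicalType) := OrientedAtlas {
  chart : Type;
  dom : chart -> set M;
  coord : chart -> M -> 'rV[R]_4;
  param : chart -> 'rV[R]_4 -> M;
  img := fun c => coord c @` dom c;
  dom_open : forall c, open (dom c);
  img_open : forall c, open (img c);
  coordK : forall c p, dom c p -> param c (coord c p) = p;
  coord_continuous : forall c, {within dom c, continuous (coord c)};
  param_continuous : forall c, {within img c, continuous (param c)};
  dom_cover : forall p, exists c, dom c p;
  transition := fun c d x => coord d (param c x);
  transition_smooth : forall c d,
    smooth (coord c @` (dom c `&` dom d)) (transition c d);
  transition_oriented : forall c d x, (coord c @` (dom c `&` dom d)) x ->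
    0 < \det (jacobian (transition c d) x)
}.

Section fields.
Variables (R : realType) (M : topologicalType) (A : oriented_atlas R M).

Definition smooth_function (w : M -> R) : Prop :=
  forall c : chart A, smooth (img c) (fun x => w (param c x) : R^o).

(* Symmetric 2-tensor fields are given by their matrices of components in each
   chart; the entries of [g c x] are g(d/dx_i, d/dx_j).  In the convention of
   [jacobian], row i of [jacobian f x] is the partial derivative of f along
   the i-th basis vector. *)
Definition tensor2 := chart A -> 'rV[R]_4 -> 'M[R]_4.

Record riemannian_metric (g : tensor2) : Prop := RiemannianMetric {
  metric_smooth : forall c, smooth (img c) (g c);
  metric_sym : forall c x, img c x -> (g c x)^T = g c x;
  metric_pos : forall c x, img c x ->
    forall v : 'rV[R]_4, v != 0 -> 0 < (v *m g c x *m v^T) 0 0;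
  metric_transition : forall c d x, (coord c @` (dom c `&` dom d)) x ->
    g c x = jacobian (transition c d) x *m g d (transition c d x)
              *m (jacobian (transition c d) x)^T
}.

Definition conformal_metric (w : M -> R) (g : tensor2) : tensor2 :=
  fun c x => expR (2 * w (param c x)) *: g c x.

End fields.

(* G is the matrix of the metric in an oriented basis e_0, ..., e_3.  A 2-form
   s is the skew-symmetric matrix of the s(e_m, e_n), a 1-form the row of its
   components. *)
Section pointwise.
Variable R : realType.
Implicit Types (G s t : 'M[R]_4).

Definition levi_civita (n : nat) (t : n.-tuple 'I_n) : R :=
  \det (\matrix_(i < n, j < n) (tnth t i == j)%:R).

(* Normalised by a /\ star b = <a, b> vol.  The 2-form b may have values in
   any vector space V. *)
Definition hodge (V : lmodType R) G (b : 'I_4 -> 'I_4 -> V) (m n : 'I_4) : V :=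
  \sum_(p < 4) \sum_(q < 4)
    (2^-1 * Num.sqrt (\det G) *
     \sum_(r < 4) \sum_(u < 4)
       levi_civita [tuple m; n; r; u] * invmx G r p * invmx G u q) *: b p q.

Definition sd_part (V : lmodType R) G (b : 'I_4 -> 'I_4 -> V) (m n : 'I_4) : V :=
  2^-1 *: (b m n + hodge G b m n).

Definition Lplus G : set 'M[R]_4 :=
  [set s | s^T = - s /\
           forall m n, hodge G (fun p q => s p q : R^o) m n = s m n].

(* For G-orthonormal 1-forms, the th_a /\ th_b with a < b are orthonormal. *)
Definition ip2 G s t : R :=
  2^-1 * \sum_(m < 4) \sum_(n < 4) \sum_(p < 4) \sum_(q < 4)
    invmx G m p * invmx G n q * s m n * t p q.

(* Row a of th is th_a. *)
Definition oriented_coframe G (th : 'M[R]_4) : Prop :=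
  th *m invmx G *m th^T = 1%:M /\ 0 < \det th.

(* An oriented orthonormal co-frame: one is chosen arbitrarily, and only used
   in expressions that do not depend on the choice. *)
Definition coframe G : 'M[R]_4 := xget 0 [set th | oriented_coframe G th].

Definition wedge (th : 'M[R]_4) (a b : 'I_4) : 'M[R]_4 :=
  \matrix_(m < 4, n < 4) (th a m * th b n - th a n * th b m).

(* The index i : 'I_3 is shifted by one: [lift ord0 i] ranges over 1, 2, 3, and
   (i, ordS i, ordS (ordS i)) are the cyclic permutations. *)
Definition Sigma G (i : 'I_3) : 'M[R]_4 :=
  let f := lift ord0 in
  - (Num.sqrt 2)^-1 *:
    (wedge (coframe G) ord0 (f i) +
     wedge (coframe G) (f (ordS i)) (f (ordS (ordS i)))).

Definition cross G s t : 'M[R]_4 :=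
  \sum_(i < 3) \sum_(j < 3) \sum_(k < 3)
    (ip2 G (Sigma G i) s * ip2 G (Sigma G j) t * levi_civita [tuple i; j; k])
      *: Sigma G k.

(* The coefficient at (m, n) of sum_i h(Sigma_i) (x) Sigma_i. *)
Definition Bform G (h : 'M[R]_4 -> 'M[R]_4) (m n : 'I_4) : 'M[R]_4 :=
  \sum_(i < 3) h (Sigma G i) m n *: Sigma G i.

(* [a, b] for a 1-form a and a 2-form b with values in the self-dual forms. *)
Definition bracket12 G (a : 'I_4 -> 'M[R]_4) (b : 'I_4 -> 'I_4 -> 'M[R]_4)
    (m n p : 'I_4) : 'M[R]_4 :=
  cross G (a m) (b n p) + cross G (a n) (b p m) + cross G (a p) (b m n).

(* The endomorphism sum_ij T_ji Sigma_j <Sigma_i, -> defined by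
   T = sum_ij T_ji Sigma_j (x) Sigma_i. *)
Definition endo G (T : 'I_4 -> 'I_4 -> 'M[R]_4) (v : 'M[R]_4) : 'M[R]_4 :=
  \matrix_(m < 4, n < 4) ip2 G (T m n) v.

(* h^-1 on the fibre of Lambda^+, when h is invertible there. *)
Definition Lplus_inv G (h : 'M[R]_4 -> 'M[R]_4) (v : 'M[R]_4) : 'M[R]_4 :=
  xget 0 [set u | Lplus G u /\ h u = v].

End pointwise.

Section local_metric.
Variables (R : realType) (g : 'rV[R]_4 -> 'M[R]_4).
Implicit Types (x : 'rV[R]_4) (l m n p q r : 'I_4).

(* Gamma^l_{mn} *)
Definition christoffel l m n x : R :=
  2^-1 * \sum_(r < 4) invmx (g x) l r *
    (pderiv m (fun y => g y r n : R^o) x + pderiv n (fun y => g y r m : R^o) x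
     - pderiv r (fun y => g y m n : R^o) x).

(* R(d_m, d_n) d_p = sum_l (riemann l p m n) d_l *)
Definition riemann l p m n x : R :=
  pderiv m (christoffel l n p : _ -> R^o) x
  - pderiv n (christoffel l m p : _ -> R^o) x
  + \sum_(r < 4) (christoffel l m r x * christoffel r n p x
                  - christoffel l n r x * christoffel r m p x).

Definition riemann_low q p m n x : R :=
  \sum_(l < 4) g x q l * riemann l p m n x.

Definition ricci p n x : R := \sum_(l < 4) riemann l p l n x.

Definition scalar_curvature x : R :=
  \sum_(p < 4) \sum_(n < 4) invmx (g x) p n * ricci p n x.

Definition weyl q p m n x : R :=
  riemann_low q p m n x
  - 2^-1 * (g x q m * ricci p n x - g x q n * ricci p m x
            - g x p m * ricci q n x + g x p n * ricci q m x)
  + scalar_curvature x / 6 * (g x q m * g x p n - g x q n * g x p m).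

(* s_mn |-> 1/2 W_mn^rl s_rl, for which the full curvature acts positively on
   round spheres. *)
Definition weyl_op x (s : 'M[R]_4) : 'M[R]_4 :=
  \matrix_(m < 4, n < 4)
    (2^-1 * \sum_(p < 4) \sum_(q < 4) \sum_(r < 4) \sum_(l < 4)
       weyl m n p q x * invmx (g x) p r * invmx (g x) q l * s r l).

(* W^+, to be applied to self-dual s. *)
Definition weyl_plus x (s : 'M[R]_4) : 'M[R]_4 :=
  \matrix_(m < 4, n < 4)
    sd_part (g x) (fun p q => weyl_op x s p q : R^o) m n.

End local_metric.

Section connections.
Variables (R : realType) (U : set 'rV[R]_4) (g : 'rV[R]_4 -> 'M[R]_4).
Implicit Types (x : 'rV[R]_4) (m n p : 'I_4).

Definition Lfield := 'rV[R]_4 -> 'M[R]_4.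

(* The covariant derivatives of a section along the coordinate vectors. *)
Definition connection := 'I_4 -> Lfield -> Lfield.

Definition section_of_Lplus (v : Lfield) : Prop :=
  smooth U v /\ forall x, U x -> Lplus (g x) (v x).

Definition LeviCivita : connection := fun m v x =>
  \matrix_(p < 4, q < 4)
    (pderiv m v x p q
     - \sum_(l < 4) christoffel g l m p x * v x l q
     - \sum_(l < 4) christoffel g l m q x * v x p l).

Definition add_connection (A : connection) (a : 'I_4 -> Lfield) : connection :=
  fun m v x => A m v x + cross (g x) (a m x) (v x).

(* d_A on Lambda^+-valued 2-forms; the cyclic sum is the component at
   (d_m, d_n, d_p). *)
Definition d2 (A : connection) (b : 'I_4 -> 'I_4 -> Lfield) m n p x :
  'M[R]_4 := A m (b n p) x + A n (b p m) x + A p (b m n) x.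

(* F_A(d_m, d_n), where f in Lambda^+ stands for the skew endomorphism [f, -]. *)
Definition curvature (A : connection) m n x : 'M[R]_4 :=
  xget 0 [set f | Lplus (g x) f /\
    forall v, section_of_Lplus v ->
      cross (g x) f (v x) = A m (A n v) x - A n (A m v) x].

Variable h : 'rV[R]_4 -> 'M[R]_4 -> 'M[R]_4.

Definition Bfield m n : Lfield := fun x => Bform (g x) (h x) m n.

(* ad_h^-1 at x: the solution a of [a, B_h] = c. *)
Definition ad_inv x (c : 'I_4 -> 'I_4 -> 'I_4 -> 'M[R]_4) :
    {ffun 'I_4 -> 'M[R]_4} :=
  xget [ffun=> 0] [set a : {ffun 'I_4 -> 'M[R]_4} |
    (forall m, Lplus (g x) (a m)) /\
    forall m n p,
      bracket12 (g x) a (Bform (g x) (h x)) m n p = c m n p].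

(* A(h) = Gamma - ad_h^-1 (d_Gamma B_h) *)
Definition Aconn : connection :=
  add_connection LeviCivita
    (fun m x => - ad_inv x (fun p q r => d2 LeviCivita Bfield p q r x) m).

(* F_A(h)^+ o h^-1 - Id *)
Definition Phi_loc x (v : 'M[R]_4) : 'M[R]_4 :=
  endo (g x) (sd_part (g x) (fun m n => curvature Aconn m n x))
    (Lplus_inv (g x) (h x) v) - v.

End connections.

Section global.
Variables (R : realType) (M : topologicalType) (A : oriented_atlas R M).

(* A field of endomorphisms of the bundle of self-dual 2-forms; only its values
   on the fibres [Lplus (g c x)], for x in [img c], are relevant. *)
Definition endo_field := chart A -> 'rV[R]_4 -> 'M[R]_4 -> 'M[R]_4.

Definition Phi (g : tensor2 A) (h : endo_field) : endo_field :=
  fun c => Phi_loc (img c) (g c) (h c).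

Definition vanishes_on_Lplus (g : tensor2 A) (h : endo_field) : Prop :=
  forall c x, img c x -> forall s, Lplus (g c x) s -> h c x s = 0.

Definition conformal_endo (w : M -> R) : endo_field :=
  fun c x s => expR (2 * w (param c x)) *: s.

Definition anti_self_dual (g : tensor2 A) : Prop :=
  vanishes_on_Lplus g (fun c => weyl_plus (g c)).

Definition has_constant_scalar_curvature (g : tensor2 A) (k : R) : Prop :=
  forall c x, img c x -> scalar_curvature (g c) x = k.

End global.

(* Main.v *)
Require Import Defs.
From mathcomp Require Import all_boot all_order all_algebra.
From mathcomp Require Import all_classical all_reals all_analysis.
From mathcomp Require Import ring lra.
Set Implicit Arguments.
Unset Strict Implicit.
Unset Printing Implicit Defensive.
Import Order.TTheory GRing.Theory Num.Theory.
Import numFieldNormedType.Exports.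
Local Open Scope classical_set_scope.
Local Open Scope ring_scope.

(** The map v |-> e^(2w) v is an isometry from the self-dual forms of g onto
    those of the conformal metric e^(2w) g (the two bundles are the same, the
    fibre metrics differ), and the connection A(h) for h = e^(2w) Id is the
    Levi-Civita connection of e^(2w) g transported by this isometry
    ([Aconn_conf]).  Indeed A(h) = Gamma + a, where a is the only Lambda^+-valued
    1-form with d_Gamma B_h + [a, B_h] = 0; uniqueness is [torsion_inj].  The
    transported connection has the form Gamma + a ([LeviCivita_conf]), and it
    satisfies the equation because B_h is the image of the form
    sum_i Sigma_i (x) Sigma_i of the conformal metric, which is annihilated by
    the exterior derivative of the torsion-free connection that makes it
    parallel ([torsion_Kern]).

    Hence the curvature of A(h) is the Riemann tensor of e^(2w) g, read through
    so(4) -> so(Lambda^+) ([curvature_conf]), and F_A(h)^+ h^-1 is sqrt 2 times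
    the self-dual block of the curvature operator of e^(2w) g ([Phi_conf]).
    That block is W^+ + s / 12 ([weyl_plusE]), with W^+ free of trace by the
    first Bianchi identity ([trace_riem_op]).  So Phi(h) = 0 says that
    W^+ + s / 12 = Id / sqrt 2.  Taking traces, this amounts to
    s = 12 / sqrt 2 = 6 sqrt 2 together with W^+ = 0 ([asd_scalar_iff]).

    Everything is local, in the domain of one chart.  The orthonormal frames
    Sigma_i are chosen at each point separately and need not vary continuously,
    so they are never differentiated.  Derivatives are taken of the tensor
    K = sum_i Sigma_i (x) Sigma_i instead, which does not depend on the frame:
    2 K is the combination g g - g g + vol of the metric and its volume form
    ([KernE]).  It is smooth and parallel, and its components span every fibre
    of Lambda^+. *)

(** * Indices and the Levi-Civita symbol in dimensions three and four *)

Section ord.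
Lemma sum4 (V : nmodType) (F : 'I_4 -> V) :
  \sum_(i < 4) F i = F (@Ordinal 4 0 isT) + F (@Ordinal 4 1 isT)
    + F (@Ordinal 4 2 isT) + F (@Ordinal 4 3 isT).
Proof.
rewrite !big_ord_recl big_ord0 addr0 !addrA.
by do !congr (_ + _); congr F; apply: val_inj.
Qed.

Lemma sum3 (V : nmodType) (F : 'I_3 -> V) :
  \sum_(i < 3) F i = F (@Ordinal 3 0 isT) + F (@Ordinal 3 1 isT)
    + F (@Ordinal 3 2 isT).
Proof.
rewrite !big_ord_recl big_ord0 addr0 !addrA.
by do !congr (_ + _); congr F; apply: val_inj.
Qed.

Lemma ord4P (P : 'I_4 -> Prop) :
  P (@Ordinal 4 0 isT) -> P (@Ordinal 4 1 isT) ->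
  P (@Ordinal 4 2 isT) -> P (@Ordinal 4 3 isT) -> forall i, P i.
Proof.
by move=> P0 P1 P2 P3 [[|[|[|[|//]]]] i4];
  rewrite (bool_irrelevance i4 isT).
Qed.

Lemma ord3P (P : 'I_3 -> Prop) :
  P (@Ordinal 3 0 isT) -> P (@Ordinal 3 1 isT) ->
  P (@Ordinal 3 2 isT) -> forall i, P i.
Proof.
by move=> P0 P1 P2 [[|[|[|//]]] i3]; rewrite (bool_irrelevance i3 isT).
Qed.
End ord.

Section levi.
Variable R : realType.

(** Both products are Vandermonde determinants, and the matrix that defines the
    symbol carries the nodes of one to those of the other.  The symbol thus
    becomes a polynomial in the indices, and identities between symbols reduce
    to linear arithmetic in finitely many cases. *)
Lemma levi_civita_Vandermonde n (t : n.-tuple 'I_n) :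
  levi_civita R t * \prod_(i < n) \prod_(j < n | (i < j)%N) (j%:R - i%:R) =
  \prod_(i < n) \prod_(j < n | (i < j)%N) ((tnth t j)%:R - (tnth t i)%:R).
Proof.
have V (a : 'I_n -> 'I_n) : \prod_(i < n) \prod_(j < n | (i < j)%N)
    ((a j)%:R - (a i)%:R) = \det (Vandermonde n (\row_j (a j)%:R : 'rV[R]_n)).
  by rewrite det_Vandermonde; apply: eq_bigr => i _; apply: eq_bigr => j _; rewrite !mxE.
rewrite (V id) V -[in LHS]det_tr -[in RHS]det_tr -det_mulmx; congr (\det _).
apply/matrixP => i k; rewrite !mxE (bigD1 (tnth t i)) //= !mxE eqxx mul1r.
by rewrite big1 ?addr0// => j /negPf jt; rewrite !mxE eq_sym jt mul0r.
Qed.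

Lemma prod4 (F : 'I_4 -> R) :
  \prod_(i < 4) F i = F (@Ordinal 4 0 isT) * F (@Ordinal 4 1 isT)
    * F (@Ordinal 4 2 isT) * F (@Ordinal 4 3 isT).
Proof.
rewrite !big_ord_recl big_ord0 mulr1 !mulrA.
by do !congr (_ * _); congr F; apply: val_inj.
Qed.

Lemma prod3 (F : 'I_3 -> R) :
  \prod_(i < 3) F i = F (@Ordinal 3 0 isT) * F (@Ordinal 3 1 isT)
    * F (@Ordinal 3 2 isT).
Proof.
rewrite !big_ord_recl big_ord0 mulr1 !mulrA.
by do !congr (_ * _); congr F; apply: val_inj.
Qed.

Lemma levi4E (a b c d : 'I_4) : levi_civita R [tuple a; b; c; d] =
  (b%:R - a%:R) * (c%:R - a%:R) * (d%:R - a%:R) *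
  (c%:R - b%:R) * (d%:R - b%:R) * (d%:R - c%:R) / 12.
Proof.
have := levi_civita_Vandermonde [tuple a; b; c; d].
under eq_bigr do rewrite big_mkcond prod4 /=.
under [RHS]eq_bigr do rewrite big_mkcond prod4 /= !(tnth_nth a) /=.
rewrite !prod4 /= => H.
(* 12 is the product of the differences of 0, 1, 2, 3 *)
by apply: (mulIf (x := 12)); rewrite ?pnatr_eq0// divfK ?pnatr_eq0//; lra.
Qed.

Lemma levi3E (a b c : 'I_3) : levi_civita R [tuple a; b; c] =
  (b%:R - a%:R) * (c%:R - a%:R) * (c%:R - b%:R) / 2.
Proof.
have := levi_civita_Vandermonde [tuple a; b; c].
under eq_bigr do rewrite big_mkcond prod3 /=.
under [RHS]eq_bigr do rewrite big_mkcond prod3 /= !(tnth_nth a) /=.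
rewrite !prod3 /= => H.
by apply: (mulIf (x := 2)); rewrite ?pnatr_eq0// divfK ?pnatr_eq0//; lra.
Qed.
End levi.

(** * The two quaternion algebras in so(4) *)

Section quaternions.
Variable R : realType.

(** The matrices [quat i] and [quat_asd i] span the two commuting ideals of
    so(4) = so(3) + so(3), the self-dual and the anti-self-dual one; up to sign
    they are left and right multiplications by unit quaternions. *)
Definition quat (i : 'I_3) : 'M[R]_4 :=
  let f := lift ord0 in
  let E a b := delta_mx a b - delta_mx b a in
  E ord0 (f i) + E (f (ordS i)) (f (ordS (ordS i))).

Definition quat_asd (i : 'I_3) : 'M[R]_4 :=
  let f := lift ord0 in
  let E a b := delta_mx a b - delta_mx b a in
  E ord0 (f i) - E (f (ordS i)) (f (ordS (ordS i))).

Lemma quatE i a b : quat i a b =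
  ((a == 0 :> nat) && (b == i.+1 :> nat))%:R
  - ((a == i.+1 :> nat) && (b == 0 :> nat))%:R
  + ((a == (i.+1 %% 3).+1 :> nat) && (b == (i.+2 %% 3).+1 :> nat))%:R
  - ((a == (i.+2 %% 3).+1 :> nat) && (b == (i.+1 %% 3).+1 :> nat))%:R.
Proof.
rewrite !mxE -!val_eqE /= /bump /= !add1n.
have -> : ((i.+1 %% 3).+1 %% 3 = i.+2 %% 3)%N by case: i => [[|[|[|]]]].
by rewrite addrA.
Qed.

Lemma quat_asdE i a b : quat_asd i a b =
  ((a == 0 :> nat) && (b == i.+1 :> nat))%:R
  - ((a == i.+1 :> nat) && (b == 0 :> nat))%:R
  - ((a == (i.+1 %% 3).+1 :> nat) && (b == (i.+2 %% 3).+1 :> nat))%:R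
  + ((a == (i.+2 %% 3).+1 :> nat) && (b == (i.+1 %% 3).+1 :> nat))%:R.
Proof.
rewrite !mxE -!val_eqE /= /bump /= !add1n.
have -> : ((i.+1 %% 3).+1 %% 3 = i.+2 %% 3)%N by case: i => [[|[|[|]]]].
by rewrite opprB addrA addrAC.
Qed.

Lemma quat_tr i : (quat i)^T = - quat i.
Proof.
have D a b : (delta_mx a b - delta_mx b a)^T = - (delta_mx a b - delta_mx b a) :> 'M[R]_4.
  by rewrite linearB /= !trmx_delta opprB.
by rewrite /quat -[RHS]opprK opprK opprD -!D; exact: raddfD.
Qed.

Lemma quatM i j : quat i *m quat j =
  - \sum_k levi_civita R [tuple i; j; k] *: quat k - (i == j)%:R%:M.
Proof.
apply/matrixP => a b; rewrite !mxE summxE sum3 sum4 !(mxE, quatE) !levi3E -!val_eqE.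
move: i j a b; do 2!elim/ord3P; do 2!elim/ord4P => /=; lra.
Qed.

Lemma quat_asd_comm i j : quat_asd i *m quat j = quat j *m quat_asd i.
Proof.
apply/matrixP => a b; rewrite mxE [RHS]mxE !sum4 !quat_asdE !quatE.
move: i j a b; do 2!elim/ord3P; do 2!elim/ord4P => /=; lra.
Qed.

(** Twice the projection onto the self-dual ideal, which is the identity plus the
    Hodge star of the standard metric. *)
Lemma quat_kernel a b c d : \sum_i quat i a b * quat i c d =
  (a == c)%:R * (b == d)%:R - (a == d)%:R * (b == c)%:R
  + levi_civita R [tuple a; b; c; d].
Proof.
rewrite sum3 !quatE levi4E -!val_eqE.
move: a b c d; do 4!elim/ord4P => /=; lra.
Qed.

Lemma quat_asd_kernel a b c d : \sum_i quat_asd i a b * quat_asd i c d =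
  (a == c)%:R * (b == d)%:R - (a == d)%:R * (b == c)%:R
  - levi_civita R [tuple a; b; c; d].
Proof.
rewrite sum3 !quat_asdE levi4E -!val_eqE.
move: a b c d; do 4!elim/ord4P => /=; lra.
Qed.
End quaternions.

Section skew.
Variable R : realType.
Implicit Types N : 'M[R]_4.

Let pair s N : R := \sum_a \sum_b s a b * N a b.

(** The kernels of the two ideals add up to twice the projection onto the
    skew-symmetric matrices, because the Hodge stars cancel. *)
Lemma skew_decomposition N : N^T = - N ->
  4 *: N = \sum_i pair (quat R i) N *: quat R i
           + \sum_i pair (quat_asd R i) N *: quat_asd R i.
Proof.
move=> /matrixP skew; apply/matrixP => a b; rewrite mxE [RHS]mxE !summxE.
have E (q : 'I_3 -> 'M[R]_4) : \sum_i (pair (q i) N *: q i) a b =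
    \sum_c \sum_d (\sum_i q i a b * q i c d) * N c d.
  under eq_bigr do rewrite mxE mulrC mulr_sumr.
  rewrite exchange_big /=; apply: eq_bigr => c _.
  under eq_bigr do rewrite mulr_sumr.
  rewrite exchange_big /=; apply: eq_bigr => d _.
  by rewrite mulr_suml; apply: eq_bigr => i _; rewrite mulrA.
rewrite !{}E -big_split /=.
under eq_bigr do [rewrite -big_split /=; under eq_bigr do
  rewrite quat_kernel quat_asd_kernel -mulrDl addrACA subrr addr0].
have D c (F : 'I_4 -> R) : \sum_d (c == d)%:R * F d = F c.
  rewrite (bigD1 c) //= eqxx mul1r big1 ?addr0 // => d.
  by rewrite eq_sym => /negPf ->; rewrite mul0r.
transitivity (2 * (N a b - N b a)).
  by have := skew a b; rewrite !mxE => ->; lra.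
transitivity (2 * (\sum_c (a == c)%:R * (\sum_d (b == d)%:R * N c d)
                 - \sum_c (b == c)%:R * (\sum_d (a == d)%:R * N c d))).
  by rewrite !D.
rewrite -sumrB mulr_sumr; apply: eq_bigr => c _.
rewrite !mulr_sumr -sumrB mulr_sumr; apply: eq_bigr => d _; ring.
Qed.

(** The anti-self-dual part of N commutes with the self-dual ideal, so only the
    self-dual coordinates of N enter. *)
Lemma quat_comm N j : N^T = - N ->
  N *m quat R j - quat R j *m N = - \sum_i \sum_k
    (2^-1 * pair (quat R i) N * levi_civita R [tuple i; j; k]) *: quat R k.
Proof.
move=> skew; apply: (scalerI (a := 4)); first by rewrite pnatr_eq0.
rewrite scalerBr scalemxAl scalemxAr skew_decomposition //.
rewrite mulmxDl (mulmxDr (quat R j)) opprD addrACA !mulmx_suml !mulmx_sumr -!sumrB.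
rewrite [X in _ + X]big1 ?addr0; last first.
  by move=> i _; rewrite -scalemxAl -scalemxAr quat_asd_comm subrr.
rewrite scalerN scaler_sumr -sumrN; apply: eq_bigr => i _.
rewrite -scalemxAl -scalemxAr -scalerBr !quatM eq_sym opprB addrA subrK.
rewrite -sumrN opprK -big_split /= scaler_sumr scaler_sumr -sumrN; apply: eq_bigr => k _.
rewrite -scaleNr -scalerDl !scalerA -scaleNr; congr (_ *: _).
by rewrite !levi3E; field.
Qed.
End skew.

(** * Determinants and volume forms *)

Section determinants.
Variable R : realType.

Definition setrow n (A : 'M[R]_n) k (v : 'I_n -> R) : 'M[R]_n :=
  \matrix_(i, j) if i == k then v j else A i j.

Lemma det_setrow n (A : 'M[R]_n) k v :
  \det (setrow A k v) = \sum_j v j * cofactor A k j.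
Proof.
rewrite (expand_det_row _ k); apply: eq_bigr => j _; rewrite mxE eqxx.
congr (_ * (_ * \det _)); apply/matrixP => a b; rewrite !mxE.
by rewrite eq_sym (negPf (neq_lift _ _)).
Qed.

Lemma det_expand_row n (A : 'M[R]_n) k :
  \det A = \sum_j A k j * \det (setrow A k (fun l => (j == l)%:R)).
Proof.
rewrite (expand_det_row A k); apply: eq_bigr => j _; rewrite det_setrow.
rewrite (bigD1 j) //= eqxx mul1r big1 ?addr0// => l.
by rewrite eq_sym => /negPf ->; rewrite mul0r.
Qed.

(** Jacobi's formula: for D the derivative of A, the left-hand side is the
    derivative of the determinant of A. *)
Lemma sum_det_setrow n (A D : 'M[R]_n) :
  \sum_k \det (setrow A k (fun j => D k j)) = \tr (D *m \adj A).
Proof.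
rewrite /mxtrace; apply: eq_bigr => k _; rewrite det_setrow mxE.
by apply: eq_bigr => j _; rewrite [\adj A _ _]mxE.
Qed.

Lemma tr_mul_adj n (A D : 'M[R]_n) : \tr (A *m D *m \adj A) = \tr D * \det A.
Proof. by rewrite -mulmxA mxtrace_mulC -mulmxA mul_adj_mx mul_mx_scalar linearZ /= mulrC. Qed.

Let idrows (t : 4.-tuple 'I_4) : 'M[R]_4 := \matrix_(i, j) (tnth t i == j)%:R.

Lemma det4_levi (A : 'M[R]_4) : let r k := @Ordinal 4 k in
  \det A = \sum_a \sum_b \sum_c \sum_d
    A (r 0 isT) a * A (r 1 isT) b * A (r 2 isT) c * A (r 3 isT) d
    * levi_civita R [tuple a; b; c; d].
Proof.
move=> r; rewrite (det_expand_row A (r 0 isT)); apply: eq_bigr => a _.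
rewrite (det_expand_row _ (r 1 isT)) mulr_sumr; apply: eq_bigr => b _.
rewrite (det_expand_row _ (r 2 isT)) !mulr_sumr; apply: eq_bigr => c _.
rewrite (det_expand_row _ (r 3 isT)) !mulr_sumr; apply: eq_bigr => d _.
rewrite !mxE /= !mulrA; congr (_ * _); congr (\det _).
by apply/matrixP => i j; rewrite !mxE; move: i; elim/ord4P.
Qed.

Lemma idrowsM (t : 4.-tuple 'I_4) (A : 'M[R]_4) k a :
  (idrows t *m A) k a = A (tnth t k) a.
Proof.
rewrite mxE (bigD1 (tnth t k)) //= mxE eqxx mul1r big1 ?addr0// => j.
by rewrite mxE eq_sym => /negPf ->; rewrite mul0r.
Qed.

(** The coordinate expression of a volume form: th is the matrix of the
    co-frame. *)
Lemma levi_transform (th : 'M[R]_4) m n p q :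
  \sum_a \sum_b \sum_c \sum_d th a m * th b n * th c p * th d q
    * levi_civita R [tuple a; b; c; d] = \det th * levi_civita R [tuple m; n; p; q].
Proof.
rewrite mulrC -(det_tr th) -det_mulmx det4_levi.
by under [RHS]eq_bigr do under eq_bigr do under eq_bigr do under eq_bigr do
  rewrite !idrowsM ![th^T _ _]mxE.
Qed.

(** The infinitesimal version of [levi_transform]: an endomorphism acts on volume
    forms by its trace. *)
Lemma levi_derivation (C : 'M[R]_4) m n p q :
  \sum_l (C l m * levi_civita R [tuple l; n; p; q] +
          C l n * levi_civita R [tuple m; l; p; q] +
          C l p * levi_civita R [tuple m; n; l; q] +
          C l q * levi_civita R [tuple m; n; p; l]) =
  \tr C * levi_civita R [tuple m; n; p; q].
Proof.
have := sum_det_setrow (idrows [tuple m; n; p; q]) (idrows [tuple m; n; p; q] *m C^T).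
rewrite tr_mul_adj mxtrace_tr => <-; rewrite [RHS]sum4 !big_split /=.
have E k : \det (setrow (idrows [tuple m; n; p; q]) k
    (fun j => (idrows [tuple m; n; p; q] *m C^T) k j)) =
  \sum_l C l (tnth [tuple m; n; p; q] k) * \det (setrow (idrows [tuple m; n; p; q]) k (fun j =>
    (l == j)%:R)).
  rewrite (det_expand_row _ k); apply: eq_bigr => l _.
  rewrite mxE eqxx idrowsM mxE; congr (_ * \det _).
  by apply/matrixP => a b; rewrite !mxE; case: eqP.
rewrite !E; congr (_ + _ + _ + _); apply: eq_bigr => l _; congr (_ * \det _);
  apply/matrixP => a b; rewrite !mxE; by move: a; elim/ord4P.
Qed.
End determinants.

(** * Oriented orthonormal co-frames *)

Section cholesky.
Variable R : realType.

Definition inner_product n (G : 'M[R]_n) : Prop :=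
  G^T = G /\ forall v : 'rV[R]_n, v != 0 -> 0 < (v *m G *m v^T) 0 0.

(** The Schur complement of the first entry is again positive definite, which is
    what the induction needs. *)
Lemma cholesky n (G : 'M[R]_n) : inner_product G -> exists L : 'M[R]_n, G = L^T *m L.
Proof.
elim: n G => [|n IHn]; first by exists 0; apply/matrixP => -[].
rewrite -[n.+1]/(1 + n)%N => G; rewrite -(submxK G).
move: (ulsubmx G) (ursubmx G) (dlsubmx G) (drsubmx G) => a b b' c [].
rewrite tr_block_mx => /eq_block_mx[_ _ <- cT] pos {b'}.
have a0 : 0 < a 0 0.
  have /pos : row_mx 1%:M 0 != 0 :> 'rV[R]_(1 + n).
    by rewrite -row_mx0; apply/eqP => /eq_row_mx[/matrixP/(_ 0 0)/eqP]; rewrite !mxE oner_eq0.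
  rewrite tr_row_mx mul_row_block !mul0mx !addr0 mul_row_col trmx0 mulmx0 addr0.
  by rewrite mul1mx tr_scalar_mx mulmx1.
have aE : a = (a 0 0)%:M by rewrite [LHS]mx11_scalar.
pose s := Num.sqrt (a 0 0); have s0 : s != 0 by rewrite sqrtr_eq0 -ltNge.
have ss : s * s = a 0 0 by rewrite -expr2 sqr_sqrtr// ltW.
have [] := IHn (c - (a 0 0)^-1 *: (b^T *m b)).
  split; first by rewrite linearB /= cT linearZ /= trmx_mul trmxK.
  move=> w w0; have := pos (row_mx (- (a 0 0)^-1 *: (w *m b^T)) w).
  set v := row_mx _ _; have v0 : v != 0.
    by apply: contraNneq w0; rewrite -[0]row_mx0 => /eq_row_mx[_ ->].
  move=> /(_ v0); rewrite tr_row_mx mul_row_block mul_row_col.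
  have -> : - (a 0 0)^-1 *: (w *m b^T) *m a = - (w *m b^T).
    by rewrite [X in _ *m X]aE mul_mx_scalar scalerA mulrN mulfV ?gt_eqF// scaleN1r.
  rewrite addNr mul0mx add0r.
  congr (0 < fun_of_matrix (_ *m _) 0 0).
  by rewrite mulmxBr addrC -scalemxAr scaleNr mulNmx -scalemxAl mulmxA.
move=> L' L'E; exists (block_mx s%:M (s^-1 *: b) 0 L').
rewrite tr_block_mx mulmx_block !trmx0 !mul0mx !mulmx0 !addr0 tr_scalar_mx -L'E.
congr block_mx.
- by rewrite -scalar_mxM ss -aE.
- by rewrite mul_scalar_mx scalerA mulfV// scale1r.
- by rewrite linearZ /= mul_mx_scalar scalerA mulfV// scale1r.
- have -> : (s^-1 *: b)^T = s^-1 *: b^T by rewrite linearZ.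
  rewrite -scalemxAl -scalemxAr scalerA -invfM ss.
  by rewrite addrC subrK.
Qed.

(** A Cholesky factor is an orthonormal co-frame; changing the sign of its first
    covector reverses the orientation. *)
Lemma inner_product_oriented_coframe (G : 'M[R]_4) :
  inner_product G -> exists th, oriented_coframe G th.
Proof.
move=> Gip; have [L GL] := cholesky Gip; case: Gip => _ pos.
have Lu : L \in unitmx.
  rewrite unitmxE unitfE -det_tr; apply/negP => /det0P[v v0 vL].
  by have := pos v v0; rewrite GL !mulmxA vL !mul0mx mxE ltxx.
have LG : L *m invmx G *m L^T = 1%:M.
  apply: mulmx1C; rewrite mulmxA -GL mulmxV// GL unitmxE det_mulmx unitrM.
  by rewrite -!unitmxE unitmx_tr Lu.
have [d0|d0] := ltP 0 (\det L); first by exists L.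
have {d0} d0 : \det L < 0 by rewrite lt_neqAle d0 andbT -unitfE -unitmxE.
(* the reflection of the first covector *)
pose D : 'M[R]_4 := diag_mx (\row_i if i == ord0 then -1 else 1).
exists (D *m L); split; last first.
  rewrite det_mulmx det_diag (bigD1 ord0)//= big1 ?mulr1; last first.
    by move=> i /negPf i0; rewrite mxE i0.
  by rewrite mxE eqxx mulN1r oppr_gt0.
rewrite trmx_mul tr_diag_mx !mulmxA -(mulmxA D) -(mulmxA D) LG mulmx1.
rewrite mulmx_diag; apply/matrixP => i j; rewrite !mxE.
by case: (i == j) => //=; case: (i == ord0); rewrite ?mulrNN ?mulr1.
Qed.

Lemma coframeP (G : 'M[R]_4) : inner_product G -> oriented_coframe G (coframe G).
Proof.
by move=> /inner_product_oriented_coframe[th thG]; exact: (xgetPex 0 (ex_intro _ th thG)).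
Qed.

End cholesky.

Local Opaque quat quat_asd.

(** * The frame of self-dual forms *)

Section frame.
Variables (R : realType) (G : 'M[R]_4).
Hypothesis Gip : inner_product G.
Implicit Types s t N : 'M[R]_4.

Let th := coframe G.
Let c : R := (Num.sqrt 2)^-1.

Lemma sqrt2_neq0 : Num.sqrt 2 != 0 :> R.
Proof. by rewrite sqrtr_eq0 -ltNge. Qed.

Lemma sqrt2M : Num.sqrt 2 * Num.sqrt 2 = 2 :> R.
Proof. by rewrite -expr2 sqr_sqrtr. Qed.

Lemma isqrt2M : c * c = 2^-1.
Proof. by rewrite -invfM sqrt2M. Qed.

Lemma coframe_det : 0 < \det th.
Proof. by have [] := coframeP Gip. Qed.

Lemma coframeK : th *m invmx G *m th^T = 1%:M.
Proof. by have [] := coframeP Gip. Qed.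

Lemma metric_unit : G \in unitmx.
Proof.
have := congr1 determinant coframeK; rewrite !det_mulmx det1 => d.
rewrite -unitmx_inv unitmxE unitfE; apply/eqP => i0; move/eqP: d.
by rewrite i0 mulr0 mul0r eq_sym oner_eq0.
Qed.

Lemma coframe_metric : G = th^T *m th.
Proof.
have := mulmx1C (etrans (mulmxA _ _ _) coframeK).
move=> /(congr1 (mulmx G)); rewrite mulmx1 !mulmxA mulmxV ?mul1mx// metric_unit//.
Qed.

Lemma sqrt_det_metric : Num.sqrt (\det G) = \det th.
Proof. by rewrite coframe_metric det_mulmx det_tr -expr2 sqrtr_sqr gtr0_norm ?coframe_det. Qed.

Lemma det_metric_gt0 : 0 < \det G.
Proof. by rewrite coframe_metric det_mulmx det_tr mulr_gt0 ?coframe_det. Qed.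

Lemma metric_sym_entry m n : G m n = G n m.
Proof. by case: Gip => /matrixP/(_ n m); rewrite mxE => ->. Qed.

Lemma invmetric_tr : (invmx G)^T = invmx G.
Proof. by rewrite trmx_inv; case: Gip => ->. Qed.

Lemma invmetric_sym a b : invmx G a b = invmx G b a.
Proof. by rewrite -[in RHS]invmetric_tr mxE. Qed.

(** Coordinate components of a tensor given by its components in the co-frame.
    Products become products twisted by [invmx G] ([pull_mul]), which transfers
    the quaternion identities to the forms Sigma_i. *)
Let pull (A : 'M[R]_4) := th^T *m A *m th.

Lemma pullE A m n : pull A m n = \sum_a \sum_b th a m * th b n * A a b.
Proof.
rewrite mxE exchange_big /=; apply: eq_bigr => b _; rewrite mxE mulr_suml.
by apply: eq_bigr => a _; rewrite mxE; ring.
Qed.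

Lemma pullD A B : pull (A + B) = pull A + pull B.
Proof. by rewrite /pull mulmxDr mulmxDl. Qed.

Lemma pullZ a A : pull (a *: A) = a *: pull A.
Proof. by rewrite /pull -scalemxAr -scalemxAl. Qed.

Lemma pullN A : pull (- A) = - pull A.
Proof. by rewrite /pull mulmxN mulNmx. Qed.

Lemma pull_sum I (r : seq I) (F : I -> 'M[R]_4) :
  pull (\sum_(i <- r) F i) = \sum_(i <- r) pull (F i).
Proof. by rewrite /pull mulmx_sumr mulmx_suml. Qed.

Lemma pull1 : pull 1%:M = G.
Proof. by rewrite /pull mulmx1 -coframe_metric. Qed.

Lemma pull_tr A : (pull A)^T = pull A^T.
Proof. by rewrite /pull !trmx_mul trmxK mulmxA. Qed.

Lemma pull_mul A B : pull A *m invmx G *m pull B = pull (A *m B).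
Proof.
rewrite /pull !mulmxA; congr (_ *m _ *m _).
by rewrite -!mulmxA [X in _ *m (_ *m X)]mulmxA coframeK mulmx1.
Qed.

Lemma pull_surj N : exists A, N = pull A.
Proof.
exists (invmx th^T *m N *m invmx th); have thu : th \in unitmx.
  by rewrite unitmxE unitfE gt_eqF ?coframe_det.
by rewrite /pull !mulmxA mulmxV ?unitmx_tr// mul1mx -mulmxA mulVmx// mulmx1.
Qed.

Lemma pull_inj A B : pull A = pull B -> A = B.
Proof.
have thu : th \in unitmx by rewrite unitmxE unitfE gt_eqF ?coframe_det.
move=> /(congr1 (fun N => invmx th^T *m N *m invmx th)).
by rewrite /pull !mulmxA mulVmx ?unitmx_tr// !mul1mx -!mulmxA mulmxV// !mulmx1.
Qed.

Lemma SigmaE i : Sigma G i = - c *: pull (quat R i).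
Proof.
have W a b : wedge th a b = pull (delta_mx a b - delta_mx b a).
  have D (x y : 'I_4) m n : pull (delta_mx x y) m n = th x m * th y n.
    rewrite /pull -(mul_delta_mx (0 : 'I_1)) mulmxA -colE -mulmxA -rowE mxE big_ord1.
    by rewrite !mxE.
  apply/matrixP => m n; rewrite pullD pullN mxE [RHS]mxE [X in _ = _ + X]mxE !D.
  by rewrite (mulrC (th a n)).
by rewrite /Sigma !W -pullD.
Qed.

Lemma Sigma_tr i : (Sigma G i)^T = - Sigma G i.
Proof. by rewrite SigmaE linearZ /= pull_tr quat_tr pullN scalerN. Qed.

(** The quaternion relations, read in the co-frame. *)
Lemma Sigma_mul i j : Sigma G i *m invmx G *m Sigma G j =
  c *: (\sum_k levi_civita R [tuple i; j; k] *: Sigma G k) - (2^-1 * (i == j)%:R) *: G.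
Proof.
rewrite !SigmaE -!scalemxAl -scalemxAr pull_mul quatM scalerA mulrNN isqrt2M.
rewrite pullD !pullN pull_sum -scalemx1 pullZ pull1 scalerBr scalerA; congr (_ - _).
rewrite scalerN -scaleNr scaler_sumr scaler_sumr; apply: eq_bigr => k _.
rewrite pullZ SigmaE !scalerA; congr (_ *: _); rewrite -isqrt2M /c; ring.
Qed.

(** The bivector dual to the 2-form s. *)
Definition sharp s := invmx G *m s *m invmx G.

Lemma sharpE s p q : sharp s p q = \sum_m \sum_n invmx G m p * invmx G n q * s m n.
Proof.
rewrite mxE exchange_big /=; apply: eq_bigr => n _.
rewrite mxE mulr_suml; apply: eq_bigr => m _.
by rewrite (invmetric_sym p); ring.
Qed.

Lemma ip2E s t : ip2 G s t = 2^-1 * \sum_p \sum_q sharp s p q * t p q.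
Proof.
congr (_ * _); transitivity (\sum_p \sum_q \sum_m \sum_n
    invmx G m p * invmx G n q * s m n * t p q); last first.
  apply: eq_bigr => p _; apply: eq_bigr => q _; rewrite sharpE mulr_suml.
  by apply: eq_bigr => m _; rewrite mulr_suml.
rewrite pair_big /= [RHS]pair_big /=; under eq_bigr do rewrite pair_big /=.
by rewrite exchange_big /=; apply: eq_bigr => -[p q] _ /=; rewrite pair_big.
Qed.

Lemma ip2_tr s t : ip2 G s t = 2^-1 * \tr (t^T *m sharp s).
Proof.
rewrite ip2E; congr (_ * _); rewrite /mxtrace exchange_big /=; apply: eq_bigr => q _.
by rewrite [RHS]mxE; apply: eq_bigr => p _; rewrite [t^T _ _]mxE mulrC.
Qed.

Lemma ip2C s t : ip2 G s t = ip2 G t s.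
Proof.
rewrite !ip2_tr; congr (_ * _); rewrite -[LHS]mxtrace_tr trmx_mul trmxK /sharp.
by rewrite !trmx_mul invmetric_tr -!mulmxA [LHS]mxtrace_mulC !mulmxA.
Qed.

Lemma ip2Dr s t u : ip2 G s (t + u) = ip2 G s t + ip2 G s u.
Proof. by rewrite !ip2_tr [(_ + _)^T]linearD mulmxDl linearD mulrDr. Qed.

Lemma ip2Zr s a t : ip2 G s (a *: t) = a * ip2 G s t.
Proof. by rewrite !ip2_tr linearZ /= -scalemxAl linearZ /= mulrCA. Qed.

Lemma ip2_sumr s I (r : seq I) (P : pred I) (F : I -> 'M[R]_4) :
  ip2 G s (\sum_(i <- r | P i) F i) = \sum_(i <- r | P i) ip2 G s (F i).
Proof.
apply: (big_morph (ip2 G s)); first exact: ip2Dr.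
by rewrite -[X in ip2 G s X](scale0r 0) ip2Zr mul0r.
Qed.

Lemma tr_skew s : s^T = - s -> \tr (s *m invmx G) = 0.
Proof.
move=> st; have : \tr (s *m invmx G) = - \tr (s *m invmx G).
  rewrite -{1}mxtrace_tr trmx_mul invmetric_tr st mulmxN linearN /=.
  by rewrite mxtrace_mulC.
by move=> /eqP; rewrite -addr_eq0 -mulr2n mulrn_eq0 /= => /eqP.
Qed.

Lemma ip2_skew s t : t^T = - t ->
  ip2 G s t = - 2^-1 * \tr (t *m invmx G *m s *m invmx G).
Proof. by move=> tt; rewrite ip2_tr tt mulNmx linearN /= mulrN mulNr /sharp !mulmxA. Qed.

Lemma ip2_Sigma i j : ip2 G (Sigma G i) (Sigma G j) = (i == j)%:R.
Proof.
rewrite ip2_skew ?Sigma_tr// Sigma_mul mulmxBl linearB /= -!scalemxAl !linearZ /=.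
rewrite mulmx_suml linear_sum /= big1 ?mulr0 ?sub0r; last first.
  by move=> k _; rewrite -scalemxAl linearZ /= tr_skew ?mulr0 ?Sigma_tr.
by rewrite mulmxV ?metric_unit// mxtrace1 eq_sym add0r /GRing.scale /=; field.
Qed.

Lemma metricE m p : G m p = \sum_a th a m * th a p.
Proof. by rewrite {1}coframe_metric mxE; apply: eq_bigr => a _; rewrite mxE. Qed.

Lemma sum_delta (F : 'I_4 -> R) a : \sum_d F d * (a == d)%:R = F a.
Proof.
rewrite (bigD1 a) //= eqxx mulr1 big1 ?addr0 // => d.
by rewrite eq_sym => /negPf ->; rewrite mulr0.
Qed.

(** The left-hand side is the kernel of the projection onto the self-dual forms
    and so does not depend on the frame.  In this form it can be differentiated,
    whereas the frame itself may be discontinuous in the base point. *)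
Lemma Sigma_kernel m n p q : \sum_i Sigma G i m n * Sigma G i p q =
  2^-1 * (G m p * G n q - G m q * G n p
          + Num.sqrt (\det G) * levi_civita R [tuple m; n; p; q]).
Proof.
transitivity (2^-1 * \sum_a \sum_b \sum_d \sum_e th a m * th b n * th d p * th e q *
    \sum_i quat R i a b * quat R i d e).
  rewrite mulr_sumr; under eq_bigr => i _.
    rewrite !SigmaE [X in X * _]mxE [X in _ * X]mxE mulrACA mulrNN isqrt2M !pullE.
    rewrite mulr_suml mulr_sumr; over.
  rewrite exchange_big /=; apply: eq_bigr => a _.
  rewrite mulr_sumr; under eq_bigr do rewrite mulr_suml mulr_sumr.
  rewrite exchange_big /=; apply: eq_bigr => b _.
  rewrite mulr_sumr; under eq_bigr do rewrite !mulr_sumr.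
  rewrite exchange_big /=; apply: eq_bigr => d _.
  rewrite mulr_sumr; under eq_bigr do rewrite !mulr_sumr.
  rewrite exchange_big /=; apply: eq_bigr => e _.
  by rewrite !mulr_sumr; apply: eq_bigr => i _; ring.
rewrite sqrt_det_metric -levi_transform !metricE; congr (_ * _).
rewrite !mulr_suml -sumrB -big_split /=; apply: eq_bigr => a _.
rewrite !mulr_sumr -sumrB -big_split /=; apply: eq_bigr => b _.
transitivity (\sum_d \sum_e (th a m * th b n * th d p * th e q * (b == e)%:R) * (a == d)%:R
  - \sum_d \sum_e (th a m * th b n * th d p * th e q * (a == e)%:R) * (b == d)%:R
  + \sum_d \sum_e th a m * th b n * th d p * th e q * levi_civita R [tuple a; b; d; e]).
  rewrite -sumrB -big_split /=; apply: eq_bigr => d _.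
  rewrite -sumrB -big_split /=; apply: eq_bigr => e _.
  by rewrite quat_kernel; ring.
congr (_ - _ + _); under eq_bigr do rewrite -mulr_suml sum_delta; rewrite sum_delta; ring.
Qed.

(** The Lie algebra so(4) acts on the self-dual forms through its self-dual
    ideal. *)
Lemma commutator_Sigma N j : N^T = - N ->
  N *m invmx G *m Sigma G j - Sigma G j *m invmx G *m N =
  Num.sqrt 2 *: \sum_i \sum_k
     (ip2 G (Sigma G i) N * levi_civita R [tuple i; j; k]) *: Sigma G k.
Proof.
have [A ->] := pull_surj N; rewrite pull_tr -pullN => /pull_inj A_skew.
have E i : ip2 G (Sigma G i) (pull A) = - c * (2^-1 * \sum_a \sum_b quat R i a b * A a b).
  rewrite ip2C ip2_skew ?Sigma_tr// SigmaE -!scalemxAl pull_mul /pull.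
  rewrite linearZ /= -[_ *m th *m _]mulmxA mxtrace_mulC !mulmxA coframeK mul1mx.
  rewrite mulrCA; congr (_ * _); rewrite mulNr -mulrN; congr (_ * _).
  rewrite /mxtrace -sumrN; apply: eq_bigr => a _; rewrite mxE -sumrN; apply: eq_bigr => b _.
  by have /matrixP/(_ a b) := A_skew; rewrite !mxE => ->; rewrite mulrN opprK.
rewrite SigmaE -!scalemxAl -scalemxAr !pull_mul -scalerBr -pullN -pullD quat_comm //.
rewrite pullN pull_sum scalerN -scaleNr opprK !scaler_sumr; apply: eq_bigr => i _.
rewrite pull_sum !scaler_sumr; apply: eq_bigr => k _; rewrite E pullZ SigmaE !scalerA.
congr (_ *: _); rewrite /c; field; exact: sqrt2_neq0.
Qed.

End frame.

(** * Self-dual forms and their cross product *)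

Section selfdual.
Variables (R : realType) (G : 'M[R]_4).
Hypothesis Gip : inner_product G.
Implicit Types s t v N : 'M[R]_4.

(** The orthogonal projection of Lambda^2 onto Lambda^+. *)
Definition proj s : 'M[R]_4 := \sum_i ip2 G (Sigma G i) s *: Sigma G i.

Lemma metricV m p : \sum_r G m r * invmx G r p = (m == p)%:R.
Proof.
have /matrixP/(_ m p) := mulmxV (metric_unit Gip); rewrite mxE => ->.
by rewrite mxE.
Qed.

(** On skew-symmetric arrays the Hodge star is twice the self-dual projection
    minus the identity. *)
Lemma hodge_coef m n p q :
  2^-1 * Num.sqrt (\det G) * \sum_r \sum_u
     levi_civita R [tuple m; n; r; u] * invmx G r p * invmx G u q =
  (\sum_i Sigma G i m n * sharp G (Sigma G i) p q) -
  2^-1 * ((m == p)%:R * (n == q)%:R - (m == q)%:R * (n == p)%:R).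
Proof.
have -> : \sum_i Sigma G i m n * sharp G (Sigma G i) p q =
    \sum_r \sum_u invmx G r p * invmx G u q * \sum_i Sigma G i m n * Sigma G i r u.
  under eq_bigr do rewrite sharpE // mulr_sumr.
  rewrite exchange_big /=; apply: eq_bigr => r _.
  under eq_bigr do rewrite mulr_sumr.
  rewrite exchange_big /=; apply: eq_bigr => u _.
  by rewrite mulr_sumr; apply: eq_bigr => i _; ring.
have P m' n' : (m' == p)%:R * (n' == q)%:R =
    \sum_r \sum_u G m' r * invmx G r p * (G n' u * invmx G u q).
  rewrite -!metricV mulr_suml; apply: eq_bigr => r _; exact: mulr_sumr.
rewrite P [X in _ - _ * (_ - X)]mulrC P -sumrB mulr_sumr mulr_sumr -sumrB.
apply: eq_bigr => r _; rewrite -sumrB mulr_sumr mulr_sumr -sumrB.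
by apply: eq_bigr => u _; rewrite Sigma_kernel //; field.
Qed.

Lemma sd_part_skew (V : lmodType R) (b : 'I_4 -> 'I_4 -> V) m n :
  (forall p q, b q p = - b p q) ->
  sd_part G b m n = \sum_i Sigma G i m n *:
    (2^-1 *: \sum_p \sum_q sharp G (Sigma G i) p q *: b p q).
Proof.
move=> skew; rewrite /sd_part.
have -> : b m n + hodge G b m n =
    \sum_p \sum_q (\sum_i Sigma G i m n * sharp G (Sigma G i) p q) *: b p q.
  rewrite /hodge; under eq_bigr do under eq_bigr do rewrite hodge_coef scalerBl.
  under eq_bigr do rewrite sumrB; rewrite sumrB.
  rewrite [X in _ + (_ - X)](_ : _ = b m n); first by rewrite addrC subrK.
  have D k l : \sum_p \sum_q ((k == p)%:R * (l == q)%:R) *: b p q = b k l.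
    rewrite (bigD1 k)//= (bigD1 l)//= !eqxx mulr1 scale1r big1 ?addr0.
      rewrite big1 ?addr0// => p; rewrite eq_sym => /negPf ->.
      by rewrite big1// => q _; rewrite mul0r scale0r.
    by move=> q; rewrite eq_sym => /negPf ->; rewrite mulr0 scale0r.
  under eq_bigr do under eq_bigr do rewrite -scalerA scalerBl.
  under eq_bigr do rewrite -scaler_sumr sumrB.
  rewrite -scaler_sumr sumrB D.
  under [X in _ *: (_ - X)]eq_bigr do under eq_bigr do rewrite [_%:R * _%:R]mulrC.
  by rewrite D (skew m n) opprK -mulr2n -(scaler_nat 2 (b m n)) scalerA mulVf ?scale1r ?pnatr_eq0.
under [RHS]eq_bigr do rewrite scalerA mulrC -scalerA.
rewrite -scaler_sumr; congr (_ *: _); under [RHS]eq_bigr do rewrite scaler_sumr.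
rewrite [RHS]exchange_big /=; apply: eq_bigr => p _; under [RHS]eq_bigr do rewrite scaler_sumr.
rewrite [RHS]exchange_big /=; apply: eq_bigr => q _.
by rewrite scaler_suml; apply: eq_bigr => i _; rewrite scalerA.
Qed.

Lemma sd_part_proj s m n : s^T = - s ->
  sd_part G (fun p q => s p q : R^o) m n = proj s m n.
Proof.
move=> /matrixP skew; rewrite sd_part_skew; last first.
  by move=> p q; have := skew p q; rewrite !mxE.
rewrite summxE; apply: eq_bigr => i _; rewrite [RHS]mxE ip2E // [RHS]mulrC.
by [].
Qed.

Lemma ip2_coord (x : 'I_3 -> R) i :
  ip2 G (Sigma G i) (\sum_j x j *: Sigma G j) = x i.
Proof.
rewrite ip2_sumr// (bigD1 i) //= ip2Zr// ip2_Sigma// eqxx mulr1 big1 ?addr0// => j.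
by rewrite ip2Zr // ip2_Sigma // eq_sym => /negPf ->; rewrite mulr0.
Qed.

Lemma proj_coord (x : 'I_3 -> R) :
  proj (\sum_j x j *: Sigma G j) = \sum_j x j *: Sigma G j.
Proof. by apply: eq_bigr => i _; rewrite ip2_coord. Qed.

Lemma coord_skew (x : 'I_3 -> R) :
  (\sum_j x j *: Sigma G j)^T = - \sum_j x j *: Sigma G j.
Proof.
rewrite linear_sum /= -sumrN; apply: eq_bigr => j _.
by rewrite linearZ /= Sigma_tr // scalerN.
Qed.

Lemma LplusP s : Lplus G s <-> s = proj s.
Proof.
have hs : s^T = - s -> forall m n,
    hodge G (fun p q => s p q : R^o) m n = 2 * proj s m n - s m n.
  move=> sT m n; rewrite -sd_part_proj // /sd_part /GRing.scale /= mulrA divff //.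
  by rewrite mul1r addrC addKr.
split=> [[sT sh]|sE].
  apply/matrixP => m n; have := sh m n; rewrite hs//; lra.
have sT : s^T = - s by rewrite sE coord_skew.
by split => // m n; rewrite hs// -sE; lra.
Qed.

Lemma Lplus_coord (x : 'I_3 -> R) : Lplus G (\sum_j x j *: Sigma G j).
Proof. by apply/LplusP; rewrite proj_coord. Qed.

Lemma Lplus_proj s : Lplus G (proj s). Proof. exact: Lplus_coord. Qed.

Lemma Lplus_Sigma i : Lplus G (Sigma G i).
Proof.
have -> : Sigma G i = \sum_j (i == j)%:R *: Sigma G j; last exact: Lplus_coord.
rewrite (bigD1 i) //= eqxx scale1r big1 ?addr0// => j; rewrite eq_sym.
by move=> /negPf ->; rewrite scale0r.
Qed.

Lemma Lplus_skew s : Lplus G s -> s^T = - s. Proof. by case. Qed.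

Lemma LplusZ a s : Lplus G s -> Lplus G (a *: s).
Proof.
move=> /LplusP ->; rewrite scaler_sumr; under eq_bigr do rewrite scalerA.
exact: Lplus_coord.
Qed.

Lemma LplusD s t : Lplus G s -> Lplus G t -> Lplus G (s + t).
Proof.
move=> /LplusP -> /LplusP ->; rewrite -big_split /=; under eq_bigr do rewrite -scalerDl.
exact: Lplus_coord.
Qed.

Lemma Lplus_sum I (r : seq I) (F : I -> 'M[R]_4) :
  (forall i, Lplus G (F i)) -> Lplus G (\sum_(i <- r) F i).
Proof.
move=> LF; apply: big_ind => //; last exact: LplusD.
by have := LplusZ 0 (Lplus_proj 0); rewrite scale0r.
Qed.

Lemma ip2Zl a s u : ip2 G (a *: s) u = a * ip2 G s u.
Proof. by rewrite !(ip2C Gip _ u) ip2Zr. Qed.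

Lemma ip20 s : ip2 G s 0 = 0.
Proof. by rewrite -[X in ip2 G s X](scale0r 0) ip2Zr // mul0r. Qed.

Lemma crossDl s t u : cross G (s + t) u = cross G s u + cross G t u.
Proof.
rewrite /cross -big_split /=; apply: eq_bigr => i _; rewrite -big_split /=; apply: eq_bigr => j _.
rewrite -big_split /=; apply: eq_bigr => k _.
by rewrite -scalerDl ip2Dr // !mulrDl.
Qed.

Lemma crossDr s t u : cross G s (t + u) = cross G s t + cross G s u.
Proof.
rewrite /cross -big_split /=; apply: eq_bigr => i _; rewrite -big_split /=; apply: eq_bigr => j _.
rewrite -big_split /=; apply: eq_bigr => k _.
by rewrite -scalerDl ip2Dr // -mulrDl mulrDr.
Qed.

Lemma crossZl a s u : cross G (a *: s) u = a *: cross G s u.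
Proof.
rewrite /cross scaler_sumr; apply: eq_bigr => i _; rewrite scaler_sumr; apply: eq_bigr => j _.
rewrite scaler_sumr; apply: eq_bigr => k _.
by rewrite ip2Zr // !scalerA !mulrA.
Qed.

Lemma crossZr a s u : cross G s (a *: u) = a *: cross G s u.
Proof.
rewrite /cross scaler_sumr; apply: eq_bigr => i _; rewrite scaler_sumr; apply: eq_bigr => j _.
rewrite scaler_sumr; apply: eq_bigr => k _.
by rewrite ip2Zr // !scalerA mulrCA !mulrA.
Qed.

Lemma cross_proj s t : cross G (proj s) t = cross G s t.
Proof.
rewrite /cross; apply: eq_bigr => i _; apply: eq_bigr => j _; apply: eq_bigr => k _.
by rewrite ip2_coord.
Qed.

(** The identification of so(Lambda^+) with Lambda^+ in terms of matrices: N acts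
    on self-dual forms as the bracket with sqrt 2 times its self-dual part. *)
Lemma cross_skew N v : N^T = - N -> Lplus G v ->
  Num.sqrt 2 *: cross G N v = N *m invmx G *m v - v *m invmx G *m N.
Proof.
move=> NT /LplusP {2 3}->.
have lin (x : 'I_3 -> R) S : N *m invmx G *m (\sum_j x j *: S j) -
    (\sum_j x j *: S j) *m invmx G *m N =
    \sum_j x j *: (N *m invmx G *m S j - S j *m invmx G *m N).
  rewrite mulmx_sumr !mulmx_suml -sumrB; apply: eq_bigr => j _.
  by rewrite -scalemxAr -!scalemxAl -scalerBr.
rewrite lin; under [RHS]eq_bigr do rewrite commutator_Sigma //.
rewrite /cross exchange_big /= scaler_sumr; apply: eq_bigr => j _.
rewrite [RHS]scalerA [_ * Num.sqrt 2]mulrC -scalerA; congr (_ *: _).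
rewrite scaler_sumr; apply: eq_bigr => i _; rewrite scaler_sumr; apply: eq_bigr => k _.
by rewrite scalerA; congr (_ *: _); ring.
Qed.

Lemma coord_cross s t k : ip2 G (Sigma G k) (cross G s t) =
  \sum_i \sum_j ip2 G (Sigma G i) s * ip2 G (Sigma G j) t * levi_civita R [tuple i; j; k].
Proof.
have -> : cross G s t = \sum_k (\sum_i \sum_j ip2 G (Sigma G i) s
     * ip2 G (Sigma G j) t * levi_civita R [tuple i; j; k]) *: Sigma G k.
  rewrite /cross; under [RHS]eq_bigr do rewrite scaler_suml.
  rewrite [RHS]exchange_big /=; apply: eq_bigr => i _.
  under [RHS]eq_bigr do rewrite scaler_suml.
  by rewrite [RHS]exchange_big.
by rewrite ip2_coord.
Qed.

Lemma Lplus_inj s t : Lplus G s -> Lplus G t ->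
  (forall i, ip2 G (Sigma G i) s = ip2 G (Sigma G i) t) -> s = t.
Proof.
move=> Ls Lt st; rewrite ((LplusP s).1 Ls) ((LplusP t).1 Lt).
by apply: eq_bigr => i _; rewrite st.
Qed.

Lemma cross_inj s t : Lplus G s -> Lplus G t ->
  (forall v, Lplus G v -> cross G s v = cross G t v) -> s = t.
Proof.
move=> Ls Lt st; apply: Lplus_inj => // i.
have E u j k : ip2 G (Sigma G k) (cross G u (Sigma G j)) =
   \sum_i ip2 G (Sigma G i) u * levi_civita R [tuple i; j; k].
  rewrite coord_cross; apply: eq_bigr => a _; rewrite (bigD1 j) //= ip2_Sigma// eqxx mulr1.
  by rewrite big1 ?addr0// => b bj; rewrite ip2_Sigma// (negPf bj) mulr0 mul0r.
have F j k : \sum_i ip2 G (Sigma G i) s * levi_civita R [tuple i; j; k] =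
    \sum_i ip2 G (Sigma G i) t * levi_civita R [tuple i; j; k].
  by rewrite -!E st //; exact: Lplus_Sigma.
have inj (x y : 'I_3 -> R) : (forall j k, \sum_i x i * levi_civita R [tuple i; j; k] =
    \sum_i y i * levi_civita R [tuple i; j; k]) -> x i = y i.
  move=> /(_ (ordS i) (ordS (ordS i))); rewrite !sum3 !levi3E.
  have m3 : ((1 %% 3 = 1)%N * (2 %% 3 = 2)%N * (3 %% 3 = 0)%N)%type by [].
  by move: i; elim/ord3P; rewrite /= !m3 /=; lra.
exact: inj F.
Qed.

Lemma levi3_contraction (b : 'I_3 -> 'I_3 -> R) k :
  \sum_i \sum_j levi_civita R [tuple i; j; k] *
    \sum_l levi_civita R [tuple k; j; l] * b i l = b k k - \sum_i b i i.
Proof.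
have E i l : \sum_j levi_civita R [tuple i; j; k] * levi_civita R [tuple k; j; l] =
    (k == i)%:R * (k == l)%:R - (i == l)%:R.
  rewrite sum3 !levi3E -!val_eqE.
  by move: i k l; do 3!elim/ord3P => /=; lra.
have D (F : 'I_3 -> R) a : \sum_l (a == l)%:R * F l = F a.
  rewrite (bigD1 a) //= eqxx mul1r big1 ?addr0 // => d.
  by rewrite eq_sym => /negPf ->; rewrite mul0r.
transitivity (\sum_i \sum_l ((k == i)%:R * (k == l)%:R - (i == l)%:R) * b i l).
  apply: eq_bigr => i _; under eq_bigr do rewrite mulr_sumr.
  rewrite exchange_big /=; apply: eq_bigr => l _.
  by rewrite -E mulr_suml; apply: eq_bigr => j _; rewrite mulrA.
under eq_bigr do under eq_bigr do rewrite mulrBl -mulrA.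
under eq_bigr do rewrite sumrB -mulr_sumr !D.
by rewrite sumrB D.
Qed.

(** Injectivity of ad_h for h a multiple of the identity.  Let al_i be the
    components of the 1-form a and be_ij the contraction of al_i with Sigma_j.
    Contracting [a, B] = 0 with Sigma_k and using the quaternion relations leaves
    be_kk = sum_i be_ii for every k ([levi3_contraction]).  Summing over k gives
    sum_i be_ii = 0, hence be_kk = 0, and Sigma_k is invertible. *)
Lemma torsion_inj (e : R) (a : 'I_4 -> 'M[R]_4) : e != 0 ->
  (forall m, Lplus G (a m)) ->
  (forall m n p, bracket12 G a (Bform G (fun s => e *: s)) m n p = 0) ->
  forall m, a m = 0.
Proof.
move=> e0 La tf.
pose al j : 'rV[R]_4 := \row_m ip2 G (Sigma G j) (a m).
pose be j l : 'rV[R]_4 := al j *m invmx G *m Sigma G l.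
have BE n p i : ip2 G (Sigma G i) (Bform G (fun s => e *: s) n p) = e * Sigma G i n p.
  by rewrite /Bform ip2_coord [LHS]mxE.
have T k m n p : \sum_i \sum_j levi_civita R [tuple i; j; k] *
    (al i 0 m * Sigma G j n p + al i 0 n * Sigma G j p m + al i 0 p * Sigma G j m n) = 0.
  have /(congr1 (ip2 G (Sigma G k))) := tf m n p.
  rewrite /bracket12 !ip2Dr // !coord_cross.
  rewrite ip20 -!big_split /= => H.
  apply: (mulfI e0); rewrite mulr0; apply: etrans H; rewrite mulr_sumr; apply: eq_bigr => i _.
  rewrite mulr_sumr -!big_split /=; apply: eq_bigr => j _.
  by rewrite !BE !mxE; ring.
have S k i j m : \sum_n \sum_p sharp G (Sigma G k) n p *
    (al i 0 m * Sigma G j n p + al i 0 n * Sigma G j p m + al i 0 p * Sigma G j m n) =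
    (k == j)%:R * al i 0 m
    + 2 * (Num.sqrt 2)^-1 * \sum_l levi_civita R [tuple k; j; l] * be i l 0 m.
  have skj l : (Sigma G l)^T = - Sigma G l by exact: Sigma_tr.
  have Y : \sum_n \sum_p sharp G (Sigma G k) n p * (al i 0 n * Sigma G j p m) =
      - 2^-1 * (k == j)%:R * al i 0 m
      + (Num.sqrt 2)^-1 * \sum_l levi_civita R [tuple k; j; l] * be i l 0 m.
    transitivity ((al i *m (sharp G (Sigma G k) *m Sigma G j)) 0 m).
      rewrite [RHS]mxE; apply: eq_bigr => n _; rewrite [X in _ * X]mxE mulr_sumr.
      by apply: eq_bigr => p _; ring.
    rewrite /sharp -!mulmxA [_ *m (invmx G *m _)]mulmxA Sigma_mul // mulmxBr mulmxBr.
    rewrite -!scalemxAr mulVmx ?metric_unit// mulmx1 addrC mxE; congr (_ + _).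
      by rewrite !mxE; ring.
    rewrite mxE; congr (_ * _); rewrite !mulmx_sumr summxE; apply: eq_bigr => l _.
    by rewrite -scalemxAr -scalemxAr [LHS]mxE /be -mulmxA.
  have Z : \sum_n \sum_p sharp G (Sigma G k) n p * (al i 0 p * Sigma G j m n) =
      \sum_n \sum_p sharp G (Sigma G k) n p * (al i 0 n * Sigma G j p m).
    rewrite exchange_big /=; apply: eq_bigr => n _; apply: eq_bigr => p _.
    have sh : sharp G (Sigma G k) p n = - sharp G (Sigma G k) n p.
      have : (sharp G (Sigma G k))^T = - sharp G (Sigma G k).
        by rewrite /sharp !trmx_mul invmetric_tr // skj mulNmx mulmxN mulmxA.
      by move=> /matrixP/(_ n p); rewrite mxE [RHS]mxE.
    have sj : Sigma G j m p = - Sigma G j p m.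
      by have /matrixP/(_ p m) := skj j; rewrite mxE [RHS]mxE.
    by rewrite sh sj; ring.
  have X : \sum_n \sum_p sharp G (Sigma G k) n p * (al i 0 m * Sigma G j n p) =
      2 * (k == j)%:R * al i 0 m.
    rewrite -(ip2_Sigma Gip) ip2E // mulrA mulfV ?pnatr_eq0// mul1r mulr_suml.
    apply: eq_bigr => n _; rewrite mulr_suml; apply: eq_bigr => p _; ring.
  under eq_bigr do under eq_bigr do rewrite !mulrDr.
  under eq_bigr do rewrite !big_split /=.
  by rewrite !big_split /= X Z Y; field; rewrite sqrt2_neq0.
have C k m : \sum_i \sum_j levi_civita R [tuple i; j; k] *
    \sum_l levi_civita R [tuple k; j; l] * be i l 0 m = 0.
  have c0 : 2 * (Num.sqrt 2)^-1 != 0 :> R by rewrite mulf_neq0 ?invr_neq0 ?sqrt2_neq0 ?pnatr_eq0.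
  apply: (mulfI c0); rewrite mulr0.
  transitivity (\sum_n \sum_p sharp G (Sigma G k) n p * \sum_i \sum_j levi_civita R [tuple i; j;
    k] *
    (al i 0 m * Sigma G j n p + al i 0 n * Sigma G j p m + al i 0 p * Sigma G j m n)); last first.
    by rewrite big1 // => n _; rewrite big1 // => p _; rewrite T mulr0.
  transitivity (\sum_i \sum_j levi_civita R [tuple i; j; k] * \sum_n \sum_p sharp G (Sigma G k) n
    p *
    (al i 0 m * Sigma G j n p + al i 0 n * Sigma G j p m + al i 0 p * Sigma G j m n)).
    rewrite mulr_sumr; apply: eq_bigr => i _; rewrite mulr_sumr; apply: eq_bigr => j _.
    rewrite S mulrDr; have -> : levi_civita R [tuple i; j; k] * ((k == j)%:R * al i 0 m) = 0.
      by have [->|kj] := eqVneq k j; rewrite ?mul0r ?mulr0// levi3E subrr !(mulr0, mul0r).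
    by rewrite add0r; ring.
  rewrite pair_big /=; under [RHS]eq_bigr do under eq_bigr do rewrite pair_big /= mulr_sumr.
  under eq_bigr do rewrite pair_big /= mulr_sumr.
  rewrite [RHS]pair_big /= exchange_big /=; apply: eq_bigr => -[n p] _.
  by apply: eq_bigr => -[i j] _ /=; rewrite mulrCA.
have be0 k m : be k k 0 m = 0.
  have D l : be l l 0 m = \sum_i be i i 0 m.
    apply/eqP; rewrite -subr_eq0 -(levi3_contraction (fun i l => be i l 0 m)).
    by apply/eqP/C.
  move: D; set t := \sum_i _ => D.
  have : t = t *+ 3 by rewrite {1}/t (eq_bigr (fun=> t)) // sumr_const card_ord.
  rewrite D; lra.
move=> m; apply: Lplus_inj => //; first by rewrite -(scale0r (a m)); exact: LplusZ.
move=> k; rewrite ip20.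
have : be k k *m invmx G *m Sigma G k = 0.
  have -> : be k k = 0 by apply/rowP => l; rewrite be0 mxE.
  by rewrite !mul0mx.
rewrite /be -!mulmxA [Sigma G k *m (_ *m _)]mulmxA Sigma_mul // eqxx.
rewrite big1 => [|l _]; last by rewrite levi3E subrr !mul0r scale0r.
rewrite scaler0 sub0r mulr1 !mulmxN -!scalemxAr mulVmx ?metric_unit// mulmx1.
move=> /rowP/(_ m); rewrite !mxE; lra.
Qed.

End selfdual.

(** * The tensor of the self-dual projection *)

Section kernel.
Variables (R : realType) (G : 'M[R]_4).
Hypothesis Gip : inner_product G.

(** The tensor sum_i Sigma_i (x) Sigma_i with the indices of its second factor
    fixed.  These sections of Lambda^+ are smooth by [KernE] and span every fibre
    by [Kern_span], so they serve as a frame that can be differentiated. *)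
Definition Kern p q : 'M[R]_4 := Bform G id p q.

Lemma KernE p q m n : Kern p q m n =
  2^-1 * (G m p * G n q - G m q * G n p
          + Num.sqrt (\det G) * levi_civita R [tuple m; n; p; q]).
Proof.
rewrite -Sigma_kernel // /Kern /Bform summxE; apply: eq_bigr => i _.
by rewrite [LHS]mxE mulrC.
Qed.

Lemma Lplus_Kern p q : Lplus G (Kern p q).
Proof. by apply: Lplus_sum => // i; apply: LplusZ => //; exact: Lplus_Sigma. Qed.

Lemma Kern_anti p q : Kern q p = - Kern p q.
Proof.
rewrite /Kern /Bform -sumrN; apply: eq_bigr => i _; rewrite -scaleNr.
have : (Sigma G i)^T = - Sigma G i by exact: Sigma_tr.
by move=> /matrixP/(_ p q); rewrite mxE [RHS]mxE => ->.
Qed.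

Lemma Kern_span v : Lplus G v ->
  v = \sum_p \sum_q (2^-1 * sharp G v p q) *: Kern p q.
Proof.
move=> /(LplusP Gip) {1}->; rewrite /proj /Kern /Bform.
transitivity (\sum_i \sum_p \sum_q (2^-1 * sharp G v p q * Sigma G i p q) *: Sigma G i).
  apply: eq_bigr => i _; rewrite ip2C // ip2E // mulr_sumr scaler_suml.
  apply: eq_bigr => p _; rewrite mulr_sumr scaler_suml.
  by apply: eq_bigr => q _; rewrite mulrA.
rewrite [LHS]exchange_big /=; apply: eq_bigr => p _.
rewrite [LHS]exchange_big /=; apply: eq_bigr => q _.
by rewrite [RHS]scaler_sumr; apply: eq_bigr => i _; rewrite [RHS]scalerA.
Qed.
End kernel.

(** * Calculus of functions of class C^k *)

Section calculus.
Variable R : realType.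
Notation E := 'rV[R]_4.
Implicit Types (U : set E) (x : E) (m n : 'I_4).

Lemma near_open (U : set E) x (P : E -> Prop) :
  open U -> U x -> (forall y, U y -> P y) -> \forall y \near x, P y.
Proof. by move=> oU Ux UP; apply: filterS UP _; exact: open_nbhs_nbhs. Qed.

Lemma pderiv_eq (V : normedModType R) U m (f g : E -> V) x : open U -> U x ->
  (forall y, U y -> f y = g y) -> pderiv m f x = pderiv m g x.
Proof. by move=> oU Ux fg; apply: near_eq_derive; exact: near_open fg. Qed.

Lemma derivable_eq (V : normedModType R) U (f g : E -> V) x v : open U -> U x ->
  (forall y, U y -> f y = g y) -> derivable f x v -> derivable g x v.
Proof. by move=> oU Ux fg; apply: near_eq_derivable; exact: near_open fg. Qed.

Lemma continuous_eq (V : normedModType R) U (f g : E -> V) x : open U -> U x ->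
  (forall y, U y -> f y = g y) -> {for x, continuous f} -> {for x, continuous g}.
Proof.
move=> oU Ux fg cf; change (g @ x --> g x); rewrite -(fg x Ux).
have nfg : \forall y \near x, f y = g y by exact: near_open fg.
exact: cvg_trans (near_eq_cvg nfg) cf.
Qed.

Lemma Ck_eq (V : normedModType R) k U (f g : E -> V) : open U ->
  (forall y, U y -> f y = g y) -> Ck k U f -> Ck k U g.
Proof.
move=> oU; elim: k f g => [|k IH] f g fg [cf df].
  by split=> // x Ux; exact: (continuous_eq oU Ux fg (cf x Ux)).
split=> [x Ux|m]; first exact: (continuous_eq oU Ux fg (cf x Ux)).
have [d c] := df m; split; first by move=> x Ux; exact: (derivable_eq oU Ux fg (d x Ux)).
by apply: IH c => y Uy; exact: (pderiv_eq m oU Uy fg).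
Qed.

Lemma CkW (V : normedModType R) k U (f : E -> V) : Ck k.+1 U f -> Ck k U f.
Proof.
elim: k f => [|k IH] f [cf df]; split => // m.
by have [d c] := df m; split => //; exact: IH.
Qed.

Section scalar.
Implicit Types f g : E -> R^o.

Lemma Ck_cst k U (c : R) : Ck k U (fun _ : E => c : R^o).
Proof.
have cc c' : forall x, U x -> {for x, continuous (fun _ : E => c' : R^o)}.
  move=> x _; exact: cst_continuous.
elim: k c => [|k IH] c; first by split; [exact: cc|].
split; [exact: cc | move=> m].
split; first by move=> x _; exact: derivable_cst.
have -> : pderiv m (fun _ : E => c : R^o) = (fun _ => 0 : R^o).
  by apply/funext => x; exact: derive_cst.
exact: IH.
Qed.

Lemma CkD k U f g : open U -> Ck k U f -> Ck k U g -> Ck k U (fun x => f x + g x : R^o).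
Proof.
move=> oU; elim: k f g => [|k IH] f g [cf df] [cg dg].
  by split=> // x Ux; exact: continuousD (cf x Ux) (cg x Ux).
split=> [x Ux|m]; first by exact: continuousD (cf x Ux) (cg x Ux).
have [{}df cdf] := df m; have [{}dg cdg] := dg m.
split=> [x Ux|]; first by apply: derivableD; [exact: df | exact: dg].
apply: (Ck_eq oU) (IH _ _ cdf cdg) => x Ux.
by rewrite /pderiv deriveD //; [exact: df | exact: dg].
Qed.

Lemma CkM k U f g : open U -> Ck k U f -> Ck k U g -> Ck k U (fun x => f x * g x : R^o).
Proof.
move=> oU; elim: k f g => [|k IH] f g Cf Cg; have [cf df] := Cf; have [cg dg] := Cg.
  by split=> // x Ux; exact: continuousM (cf x Ux) (cg x Ux).
split=> [x Ux|m]; first by exact: continuousM (cf x Ux) (cg x Ux).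
have [{}df cdf] := df m; have [{}dg cdg] := dg m.
split=> [x Ux|]; first by apply: derivableM; [exact: df | exact: dg].
apply: (Ck_eq oU) (CkD oU (IH _ _ (CkW Cf) cdg) (IH _ _ cdf (CkW Cg))) => x Ux.
rewrite /pderiv deriveM //; [|exact: df | exact: dg].
by rewrite /GRing.scale /= [X in _ = _ + X]mulrC.
Qed.

Lemma Ck_sum k U I (r : seq I) (F : I -> E -> R^o) : open U ->
  (forall i, Ck k U (F i)) -> Ck k U (fun x => \sum_(i <- r) F i x : R^o).
Proof.
move=> oU CF; elim: r => [|i r IH].
  by apply: (Ck_eq oU) (Ck_cst k U 0) => x Ux; rewrite big_nil.
by apply: (Ck_eq oU) (CkD oU (CF i) IH) => x Ux; rewrite big_cons.
Qed.

Lemma Ck_prod k U I (r : seq I) (F : I -> E -> R^o) : open U ->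
  (forall i, Ck k U (F i)) -> Ck k U (fun x => \prod_(i <- r) F i x : R^o).
Proof.
move=> oU CF; elim: r => [|i r IH].
  by apply: (Ck_eq oU) (Ck_cst k U 1) => x Ux; rewrite big_nil.
by apply: (Ck_eq oU) (CkM oU (CF i) IH) => x Ux; rewrite big_cons.
Qed.

Lemma is_derive_comp1 (phi : R -> R) f x v (d : R) :
  is_derive (f x : R) 1 phi d -> derivable f x v ->
  is_derive x v (fun y => phi (f y) : R^o) (d * 'D_v f x).
Proof.
move=> [dphi <-] df.
pose l (h : R) : R := f (h *: v + x).
have l0 : l 0 = f x by rewrite /l scale0r add0r.
have dl : derivable l 0 1 := (derivable1P f x v).1 df.
have D (h : E -> R^o) : 'D_v h x = derive1 (fun t : R => h (t *: v + x) : R^o) 0.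
  rewrite derive1E /derive; set g1 := fun h => h^-1 *: _; set g2 := fun h => h^-1 *: _.
  suff -> : g1 = g2 by [].
  by apply/funext => t; rewrite /g1 /g2 /= addr0 scale0r add0r [_%:A]mulr1.
have dphi' := eq_ind_r (fun z => derivable phi z 1) dphi l0.
split.
  apply: (derivable1P _ _ _).2; apply/derivable1_diffP.
  exact: (differentiable_comp ((derivable1_diffP l 0).1 dl) ((derivable1_diffP phi (l 0)).1 dphi')).
apply: (etrans (D (phi \o f))); apply: (etrans (derive1_comp dl dphi')).
by rewrite derive1E l0; congr (_ * _); exact/esym/D.
Qed.

Lemma Ck_exp k U f : open U -> Ck k U f -> Ck k U (fun x => expR (f x) : R^o).
Proof.
move=> oU.
have ce h x : {for x, continuous h} -> {for x, continuous (fun x => expR (h x) : R^o)}.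
  move=> ch; apply: (@continuous_comp E R R h expR x ch); exact: continuous_expR.
elim: k f => [|k IH] f Cf; have [cf df] := Cf.
  by split=> // x Ux; exact: ce (cf x Ux).
split=> [x Ux|m]; first exact: ce (cf x Ux).
have [{}df cdf] := df m.
have D x : U x -> is_derive x (delta_mx 0 m) (fun x => expR (f x) : R^o)
    (expR (f x) * 'D_(delta_mx 0 m) f x).
  by move=> Ux; apply: is_derive_comp1; exact: df.
split=> [x Ux|]; first by have [] := D x Ux.
apply: (Ck_eq oU) (CkM oU (IH _ (CkW Cf)) cdf) => x Ux.
by rewrite /pderiv (derive_val (is_derive := D x Ux)).
Qed.

(** The derivative of f^(-1/2) is a polynomial in f^(-1/2) and f', which closes
    the induction.  Square roots and inverses of positive functions are products
    of f and such factors. *)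
Lemma Ck_rsqrt k U f : open U -> (forall x, U x -> 0 < f x) -> Ck k U f ->
  Ck k U (fun x => (Num.sqrt (f x))^-1 : R^o).
Proof.
move=> oU f0.
have cr x : U x -> {for x, continuous f} ->
    {for x, continuous (fun x => (Num.sqrt (f x))^-1 : R^o)}.
  move=> Ux cf; apply: (@continuousV _ _ (Num.sqrt \o f)).
    by rewrite /= sqrtr_eq0 -ltNge f0.
  exact: (@continuous_comp _ _ _ f Num.sqrt _ cf (@sqrt_continuous _ _)).
elim: k => [|k IH] Cf; have [cf df] := Cf.
  by split=> // x Ux; exact: cr (cf x Ux).
split=> [x Ux|m]; first exact: cr (cf x Ux).
have [{}df cdf] := df m; have {}IH := IH (CkW Cf).
have D x : U x -> is_derive x (delta_mx 0 m) (fun x => (Num.sqrt (f x))^-1 : R^o)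
    (- 2^-1 * (((Num.sqrt (f x))^-1 * (Num.sqrt (f x))^-1) * (Num.sqrt (f x))^-1)
     * 'D_(delta_mx 0 m) f x).
  move=> Ux; have s0 : Num.sqrt (f x) != 0 by rewrite sqrtr_eq0 -ltNge f0.
  have [d1 d2] := @is_derive_comp1 Num.sqrt f x (delta_mx 0 m) _
    (is_derive1_sqrt (f0 x Ux)) (df x Ux).
  split; first exact: derivableV.
  rewrite deriveV // d2 /GRing.scale /=; field; exact: s0.
split=> [x Ux|]; first by have [] := D x Ux.
apply: (Ck_eq oU) (CkM oU (CkM oU (Ck_cst k U (- 2^-1)) (CkM oU (CkM oU IH IH) IH)) cdf) => x Ux.
by rewrite /pderiv (derive_val (is_derive := D x Ux)).
Qed.

End scalar.

End calculus.

Section matrix_calculus.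
Variable R : realType.
Notation E := 'rV[R]_4.
Implicit Types (U : set E) (x : E) (m n : 'I_4).

Lemma continuous_mxP p q (F : E -> 'M[R]_(p.+1, q.+1)) x :
  {for x, continuous F} <-> forall i j, {for x, continuous (fun y => F y i j : R^o)}.
Proof.
split=> [cF i j|cF].
  have ce : {for F x, continuous (fun N : 'M[R]_(p.+1, q.+1) => N i j : R)}.
    exact/differentiable_continuous/differentiable_coord.
  exact: (@continuous_comp E _ R F _ x cF ce).
have FF := @nbhs_filter E x.
apply: (cvgrPdist_le (F := nbhs x) F (F x)).2 => e e0.
have nF : \forall y \near x, forall i : 'I_p.+1 * 'I_q.+1, `|F x i.1 i.2 - F y i.1 i.2| <= e.
  apply: (@filter_forall _ _ _ (nbhs x) FF) => i.
  exact: (cvgrPdist_le (V := R^o) (F := nbhs x) (fun y => F y i.1 i.2) (F x i.1 i.2)).1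
    (cF i.1 i.2) e e0.
apply: (@filterS E (nbhs x) FF _ _ _ nF) => y Fy.
rewrite /Num.Def.normr/= mx_normrE (bigmax_le _ (ltW e0))//= => i _.
by rewrite !mxE.
Qed.

Lemma pderiv_mx p q m (F : E -> 'M[R]_(p.+1, q.+1)) x i j :
  derivable F x (delta_mx 0 m) ->
  pderiv m F x i j = pderiv m (fun y => F y i j : R^o) x.
Proof. by move=> dF; rewrite /pderiv derive_mx // mxE. Qed.

Lemma Ck_mxP p q k U (F : E -> 'M[R]_(p.+1, q.+1)) : open U ->
  Ck k U F <-> forall i j, Ck k U (fun y => F y i j : R^o).
Proof.
move=> oU; elim: k F => [|k IH] F.
  split=> [[cF _] i j|CF]; first by split => // x Ux; exact: (continuous_mxP _ _).1 (cF x Ux) i j.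
  by split => // x Ux; apply/continuous_mxP => i j; have [cF _] := CF i j; exact: cF.
split=> [[cF dF] i j|CF].
  split=> [x Ux|m]; first exact: (continuous_mxP _ _).1 (cF x Ux) i j.
  have [{}dF CdF] := dF m; split=> [x Ux|]; first exact: (derivable_mxP _ _ _).1 (dF x Ux) i j.
  apply: (Ck_eq oU) ((IH _).1 CdF i j) => x Ux.
  exact: pderiv_mx (dF x Ux).
split=> [x Ux|m].
  by apply/continuous_mxP => i j; have [cF _] := CF i j; exact: cF.
have dF x : U x -> derivable F x (delta_mx 0 m).
  by move=> Ux; apply/derivable_mxP => i j; have [_ dF] := CF i j; have [+ _] := dF m; exact.
split=> //; apply/IH => i j; have [_ /(_ m)[_ CdF]] := CF i j.
by apply: (Ck_eq oU) CdF => x Ux; rewrite pderiv_mx //; exact: dF.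
Qed.
End matrix_calculus.

(** * Symmetry of second derivatives *)

Section schwarz.
Variable R : realType.
Notation E := 'rV[R]_4.

Lemma derivable_shift (f : E -> R^o) x w v :
  derivable f (x + w) v -> derivable (fun y => f (y + w) : R^o) x v.
Proof.
rewrite /derivable; set g1 := fun h => h^-1 *: _; set g2 := fun h => h^-1 *: _.
suff -> : g1 = g2 by [].
by apply/funext => t; rewrite /g1 /g2 /= addrA.
Qed.

Lemma derive_shift (f : E -> R^o) x w v :
  'D_v (fun y => f (y + w) : R^o) x = 'D_v f (x + w).
Proof.
rewrite /derive; set g1 := fun h => h^-1 *: _; set g2 := fun h => h^-1 *: _.
suff -> : g1 = g2 by [].
by apply/funext => t; rewrite /g1 /g2 /= addrA.
Qed.

Lemma line_MVT (f : E -> R^o) x v (r : R) : 0 < r ->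
  (forall s, 0 <= s <= r -> derivable f (x + s *: v) v) ->
  exists2 s, 0 <= s <= r & f (x + r *: v) - f x = 'D_v f (x + s *: v) * r.
Proof.
move=> r0 df; pose l (s : R) : R := f (x + s *: v).
have E1 (h : R -> R^o) (g : E -> R^o) s : (forall t, h (t + s) = g (t *: v + (x + s *: v))) ->
    (fun t => t^-1 *: ((h \o shift s) (t *: 1) - h s)) =
    (fun t => t^-1 *: ((g \o shift (x + s *: v)) (t *: v) - g (x + s *: v))).
  move=> hg; apply/funext => t /=; rewrite -hg [_%:A]mulr1.
  by have := hg 0; rewrite add0r scale0r add0r => ->.
have hl s t : (l (t + s) : R^o) = f (t *: v + (x + s *: v)).
  by rewrite /l scalerDl addrCA addrA.
have dl s : 0 <= s <= r -> is_derive s 1 (l : R -> R^o) ('D_v f (x + s *: v)).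
  move=> sr; split; last by rewrite /derive (E1 l f s (hl s)).
  by have := df s sr; rewrite /derivable (E1 l f s (hl s)).
have [] := @MVT R l (fun s => 'D_v f (x + s *: v)) 0 r r0.
- by move=> s; rewrite in_itv /= => /andP[s0 sr]; apply: dl; rewrite !ltW.
- apply: derivable_within_continuous => s; rewrite in_itv /= => sr.
  by have [] := dl s sr.
- move=> s; rewrite in_itv /= => /andP[s0 sr]; rewrite subr0 /l scale0r addr0 => lE.
  by exists s => //; rewrite !ltW.
Qed.

(** The mean value theorem along v for the increment in the direction w, then
    along w for the derivative in the direction v. *)
Lemma second_difference (f : E -> R^o) x v w (r : R) : 0 < r ->
  (forall s t, 0 <= s <= r -> 0 <= t <= r -> derivable f (x + s *: v + t *: w) v /\
    derivable (fun y => 'D_v f y : R^o) (x + s *: v + t *: w) w) ->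
  exists s t, [/\ 0 <= s <= r, 0 <= t <= r &
    f (x + r *: v + r *: w) - f (x + r *: v) - (f (x + r *: w) - f x) =
    'D_w (fun y => 'D_v f y : R^o) (x + s *: v + t *: w) * r * r].
Proof.
move=> r0 H; have r0r : 0 <= r <= r by rewrite lexx ltW.
have z0r : 0 <= (0 : R) <= r by rewrite lexx ltW.
have d1 s : 0 <= s <= r -> derivable (fun y => f (y + r *: w) : R^o) (x + s *: v) v.
  by move=> sr; apply: derivable_shift; exact: (H s r sr r0r).1.
have d2 s : 0 <= s <= r -> derivable f (x + s *: v) v.
  by move=> sr; have := (H s 0 sr z0r).1; rewrite scale0r addr0.
have [s sr sE] := @line_MVT (fun y => f (y + r *: w) - f y : R^o) x v r r0
  (fun s sr => derivableB (d1 s sr) (d2 s sr)).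
have [t tr tE] := @line_MVT (fun y => 'D_v f y : R^o) (x + s *: v) w r r0
  (fun t tr => (H s t sr tr).2).
exists s, t; split => //.
transitivity ((f (x + r *: v + r *: w) - f (x + r *: v)) - (f (x + r *: w) - f x)) => //.
rewrite sE (deriveB (d1 s sr) (d2 s sr)) derive_shift.
by rewrite tE.
Qed.

(** The second difference of f over a parallelogram of size r is symmetric in the
    two directions, and it is r^2 times a value of either mixed derivative at
    some point of the parallelogram; both derivatives are continuous. *)
Lemma pderivC (U : set E) (f : E -> R^o) x m n : open U -> Ck 2 U f -> U x ->
  pderiv m (pderiv n f) x = pderiv n (pderiv m f) x.
Proof.
move=> oU [_ Cf] Ux; pose v : E := delta_mx 0 n; pose w : E := delta_mx 0 m.
have [dv [_ /(_ m)[dwv [cA _]]]] := Cf n; have [dw [_ /(_ n)[dvw [cB _]]]] := Cf m.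
apply/eqP; rewrite -subr_eq0 -normr_eq0 eq_le normr_ge0 andbT; apply/ler_addgt0Pr => e e0.
rewrite add0r; have e20 : 0 < e / 2 by rewrite divr_gt0.
set A := pderiv m (pderiv n f) in cA *; set B := pderiv n (pderiv m f) in cB *.
have FF := @nbhs_filter E x.
have nA := (@cvgrPdist_le _ R^o _ (nbhs x) FF A (A x)).1 (cA x Ux) _ e20.
have nB := (@cvgrPdist_le _ R^o _ (nbhs x) FF B (B x)).1 (cB x Ux) _ e20.
have nU : \forall y \near x, U y by exact: open_nbhs_nbhs.
pose P y := [/\ U y, `|A x - A y| <= e / 2 & `|B x - B y| <= e / 2].
have nP : nbhs x P := @filterS3 E (nbhs x) FF _ _ _ P (fun y a b c => And3 a b c) nU nA nB.
have [d d0 ball_d] := (nbhs_normP (V := E) x P).1 nP.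
have near_y y : `|x - y| < d -> P y := ball_d y.
have [N N0 vwN] : exists2 N : R, 0 < N & `|v| + `|w| <= N.
  by exists (`|v| + `|w| + 1); rewrite ?lerDl// ltr_wpDl// addr_ge0.
(* the parallelogram spanned by r v and r w stays within distance d of x *)
pose r := d / (N + N); have r0 : 0 < r by rewrite divr_gt0// addr_gt0.
have near_x s t : 0 <= s <= r -> 0 <= t <= r ->
    [/\ U (x + s *: v + t *: w), `|A x - A (x + s *: v + t *: w)| <= e / 2 &
        `|B x - B (x + s *: v + t *: w)| <= e / 2].
  move=> /andP[s0 sr] /andP[t0 tr].
  apply: near_y.
  rewrite -addrA opprD addrA subrr add0r normrN (le_lt_trans (ler_normD _ _))//.
  rewrite !normrZ !ger0_norm //.
  have : s * `|v| + t * `|w| <= r * N.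
    apply: (@le_trans _ _ (r * (`|v| + `|w|))); last by rewrite ler_wpM2l// ltW.
    by rewrite mulrDr lerD// ler_wpM2r.
  move=> /le_lt_trans; apply; rewrite /r mulrAC ltr_pdivrMr ?addr_gt0//.
  by rewrite (mulrDr d N N) ltrDl mulr_gt0.
have [s [t [sr tr E1]]] := @second_difference f x v w r r0 (fun s t sr tr =>
  let: And3 Uy _ _ := near_x s t sr tr in conj (dv _ Uy) (dwv _ Uy)).
have [t' [s' [tr' sr' E2]]] := @second_difference f x w v r r0 (fun t s tr sr =>
  let: And3 Uy _ _ := near_x s t sr tr in
  eq_ind_r (fun y => derivable f y w /\ derivable (fun y => 'D_w f y : R^o) y v)
    (conj (dw _ Uy) (dvw _ Uy)) (addrAC x (t *: w) (s *: v))).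
rewrite -/(pderiv n f) -/(pderiv m (pderiv n f) _) -/A in E1.
rewrite -/(pderiv m f) -/(pderiv n (pderiv m f) _) -/B in E2.
clearbody A B.
have AB : A (x + s *: v + t *: w) = B (x + s' *: v + t' *: w).
  have r1 : r != 0 by rewrite gt_eqF.
  apply: (mulIf r1); apply: (mulIf r1).
  rewrite -E1 (addrAC x (s' *: v)) -E2 (addrAC x (r *: w)); ring.
have [_ Ap _] := near_x s t sr tr; have [_ _ Bp] := near_x s' t' sr' tr'.
have -> : A x - B x = (A x - A (x + s *: v + t *: w)) - (B x - B (x + s' *: v + t' *: w)).
  by rewrite AB; ring.
by rewrite (le_trans (ler_normB _ _))// [leRHS]splitr lerD.
Qed.
End schwarz.

(** * Smooth functions and matrix fields *)

Section smooth_fields.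
Variables (R : realType) (U : set 'rV[R]_4).
Hypothesis oU : open U.
Notation E := 'rV[R]_4.
Implicit Types (f g : E -> R^o) (x : E) (m n : 'I_4).

Lemma smooth_eq f g : (forall y, U y -> f y = g y) -> smooth U f -> smooth U g.
Proof. by move=> fg Sf k; exact: (Ck_eq oU fg). Qed.

Lemma smooth_cst c : smooth U (fun=> c : R^o).
Proof. by move=> k; exact: Ck_cst. Qed.

Lemma smoothD f g : smooth U f -> smooth U g -> smooth U (fun x => f x + g x : R^o).
Proof. by move=> Sf Sg k; exact: CkD. Qed.

Lemma smoothM f g : smooth U f -> smooth U g -> smooth U (fun x => f x * g x : R^o).
Proof. by move=> Sf Sg k; exact: CkM. Qed.

Lemma smoothB f g : smooth U f -> smooth U g -> smooth U (fun x => f x - g x : R^o).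
Proof.
move=> Sf Sg; apply: (smooth_eq _ (smoothD Sf (smoothM (smooth_cst (-1)) Sg))) => y _.
by rewrite mulN1r.
Qed.

Lemma smooth_sum I (r : seq I) (F : I -> E -> R^o) :
  (forall i, smooth U (F i)) -> smooth U (fun x => \sum_(i <- r) F i x : R^o).
Proof. by move=> SF k; apply: Ck_sum => // i; exact: SF. Qed.

Lemma smooth_prod I (r : seq I) (F : I -> E -> R^o) :
  (forall i, smooth U (F i)) -> smooth U (fun x => \prod_(i <- r) F i x : R^o).
Proof. by move=> SF k; apply: Ck_prod => // i; exact: SF. Qed.

Lemma smooth_exp f : smooth U f -> smooth U (fun x => expR (f x) : R^o).
Proof. by move=> Sf k; exact: Ck_exp. Qed.

Lemma smooth_rsqrt f : (forall x, U x -> 0 < f x) -> smooth U f ->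
  smooth U (fun x => (Num.sqrt (f x))^-1 : R^o).
Proof. by move=> f0 Sf k; exact: Ck_rsqrt. Qed.

Lemma smooth_sqrt f : (forall x, U x -> 0 < f x) -> smooth U f ->
  smooth U (fun x => Num.sqrt (f x) : R^o).
Proof.
move=> f0 Sf; apply: smooth_eq (smoothM Sf (smooth_rsqrt f0 Sf)) => y Uy.
have fy := f0 y Uy; rewrite -{1}[f y]sqr_sqrtr ?ltW// expr2 mulfK//.
by rewrite gt_eqF// sqrtr_gt0.
Qed.

Lemma smooth_inv f : (forall x, U x -> 0 < f x) -> smooth U f ->
  smooth U (fun x => (f x)^-1 : R^o).
Proof.
move=> f0 Sf; have Sr := smooth_rsqrt f0 Sf; apply: smooth_eq (smoothM Sr Sr) => y Uy.
by rewrite -invfM -expr2 sqr_sqrtr// ltW// f0.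
Qed.

Lemma smooth_pderiv m f : smooth U f -> smooth U (pderiv m f).
Proof. by move=> Sf k; have [_ /(_ m)[_]] := Sf k.+1. Qed.

Lemma smooth_derivable m f x : smooth U f -> U x -> derivable f x (delta_mx 0 m).
Proof. by move=> Sf; have [_ /(_ m)[+ _]] := Sf 1; exact. Qed.

Lemma smooth_mxP p q (F : E -> 'M[R]_(p.+1, q.+1)) :
  smooth U F <-> forall i j, smooth U (fun y => F y i j : R^o).
Proof.
split=> [SF i j k|SF k]; first exact: (Ck_mxP _ _ oU).1 (SF k) i j.
by apply/Ck_mxP => // i j; exact: SF.
Qed.

Lemma smooth_mx_derivable p q m (F : E -> 'M[R]_(p.+1, q.+1)) x :
  smooth U F -> U x -> derivable F x (delta_mx 0 m).
Proof. by move=> SF; have [_ /(_ m)[+ _]] := SF 1; exact. Qed.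

Lemma smooth_mx_pderiv p q m (F : E -> 'M[R]_(p.+1, q.+1)) :
  smooth U F -> smooth U (pderiv m F).
Proof. by move=> SF k; have [_ /(_ m)[_]] := SF k.+1. Qed.

Lemma smooth_det k (F : E -> 'M[R]_k) : (forall i j, smooth U (fun y => F y i j : R^o)) ->
  smooth U (fun y => \det (F y) : R^o).
Proof.
move=> SF; rewrite /determinant; apply: smooth_sum => s.
by apply: smoothM; [exact: smooth_cst | exact: smooth_prod].
Qed.

Lemma smooth_invmx (F : E -> 'M[R]_4) : (forall x, U x -> 0 < \det (F x)) ->
  smooth U F -> smooth U (fun y => invmx (F y)).
Proof.
move=> F0 /smooth_mxP SF; apply/smooth_mxP => i j.
have S : smooth U (fun y => (\det (F y))^-1 * cofactor (F y) j i : R^o).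
  apply: smoothM; first by apply: smooth_inv => //; exact: smooth_det.
  rewrite /cofactor; apply: smoothM; first exact: smooth_cst.
  by apply: smooth_det => a b; apply: smooth_eq (SF (lift j a) (lift i b)) => y _; rewrite !mxE.
apply: smooth_eq S => y Uy; rewrite /invmx unitmxE unitfE gt_eqF ?F0//.
by rewrite !mxE.
Qed.

Lemma pderivD m f g x : smooth U f -> smooth U g -> U x ->
  pderiv m (fun y => f y + g y : R^o) x = pderiv m f x + pderiv m g x.
Proof. by move=> Sf Sg Ux; rewrite /pderiv deriveD //; exact: smooth_derivable. Qed.

Lemma pderivM m f g x : smooth U f -> smooth U g -> U x ->
  pderiv m (fun y => f y * g y : R^o) x = pderiv m f x * g x + f x * pderiv m g x.
Proof.
move=> Sf Sg Ux; rewrite /pderiv deriveM; [|exact: smooth_derivable..].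
by rewrite /GRing.scale /= addrC; congr (_ + _); exact: mulrC.
Qed.

Lemma pderivZ m (c : R) f x : smooth U f -> U x ->
  pderiv m (fun y => c * f y : R^o) x = c * pderiv m f x.
Proof. by move=> Sf Ux; rewrite /pderiv -[fun _ => _]/(c \*: f) deriveZ//;
  exact: smooth_derivable. Qed.

Lemma pderiv_sum m I (r : seq I) (F : I -> E -> R^o) x :
  (forall i, smooth U (F i)) -> U x ->
  pderiv m (fun y => \sum_(i <- r) F i y : R^o) x = \sum_(i <- r) pderiv m (F i) x.
Proof.
move=> SF Ux; elim: r => [|i r IH].
  rewrite big_nil -[RHS](derive_cst (0 : R^o) x (delta_mx 0 m)).
  by apply: (pderiv_eq m oU Ux) => y _; rewrite big_nil.
rewrite big_cons -IH -pderivD //; last exact: smooth_sum.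
by apply: (pderiv_eq m oU Ux) => y _; rewrite big_cons.
Qed.

Lemma smooth_mulmx p q r (A : E -> 'M[R]_(p.+1, q.+1)) (B : E -> 'M[R]_(q.+1, r.+1)) :
  smooth U A -> smooth U B -> smooth U (fun y => A y *m B y).
Proof.
move=> /smooth_mxP SA /smooth_mxP SB; apply/smooth_mxP => i j.
have S : smooth U (fun y => \sum_k A y i k * B y k j : R^o).
  by apply: smooth_sum => k; exact: smoothM.
by apply: smooth_eq S => y _; rewrite mxE.
Qed.

Lemma smooth_trmx p q (A : E -> 'M[R]_(p.+1, q.+1)) : smooth U A -> smooth U (fun y => (A y)^T).
Proof.
move=> /smooth_mxP SA; apply/smooth_mxP => i j.
by apply: smooth_eq (SA j i) => y _; rewrite mxE.
Qed.

Lemma smooth_mxB p q (A B : E -> 'M[R]_(p.+1, q.+1)) :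
  smooth U A -> smooth U B -> smooth U (fun y => A y - B y).
Proof.
move=> /smooth_mxP SA /smooth_mxP SB; apply/smooth_mxP => i j.
by apply: smooth_eq (smoothB (SA i j) (SB i j)) => y _; rewrite !mxE.
Qed.

Lemma smooth_scalemx p q f (A : E -> 'M[R]_(p.+1, q.+1)) :
  smooth U f -> smooth U A -> smooth U (fun y => f y *: A y).
Proof.
move=> Sf /smooth_mxP SA; apply/smooth_mxP => i j.
by apply: smooth_eq (smoothM Sf (SA i j)) => y _; rewrite !mxE.
Qed.

Lemma pderiv_mxE p q m (F : E -> 'M[R]_(p.+1, q.+1)) x i j : smooth U F -> U x ->
  pderiv m F x i j = pderiv m (fun y => F y i j : R^o) x.
Proof. by move=> SF Ux; apply: pderiv_mx; exact: smooth_mx_derivable. Qed.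

Lemma pderiv_mulmx p q r m (A : E -> 'M[R]_(p.+1, q.+1)) (B : E -> 'M[R]_(q.+1, r.+1)) x :
  smooth U A -> smooth U B -> U x ->
  pderiv m (fun y => A y *m B y) x = pderiv m A x *m B x + A x *m pderiv m B x.
Proof.
move=> SA SB Ux; apply/matrixP => i j.
rewrite pderiv_mxE //; last exact: smooth_mulmx.
have S k : smooth U (fun y => A y i k * B y k j : R^o).
  by apply: smoothM; [exact: (smooth_mxP A).1 | exact: (smooth_mxP B).1].
transitivity (\sum_k pderiv m (fun y => A y i k * B y k j : R^o) x).
  by rewrite -pderiv_sum //; apply: (pderiv_eq m oU Ux) => y _; rewrite mxE.
rewrite !mxE -big_split; apply: eq_bigr => k _ /=.
by rewrite pderivM ?pderiv_mxE//; [exact: (smooth_mxP A).1 | exact: (smooth_mxP B).1].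
Qed.

Lemma pderiv_trmx p q m (A : E -> 'M[R]_(p.+1, q.+1)) x : smooth U A -> U x ->
  pderiv m (fun y => (A y)^T) x = (pderiv m A x)^T.
Proof.
move=> SA Ux; apply/matrixP => i j; rewrite pderiv_mxE //; last exact: smooth_trmx.
by rewrite mxE pderiv_mxE //; apply: (pderiv_eq m oU Ux) => y _; rewrite mxE.
Qed.

Lemma pderiv_mxB p q m (A B : E -> 'M[R]_(p.+1, q.+1)) x :
  smooth U A -> smooth U B -> U x ->
  pderiv m (fun y => A y - B y) x = pderiv m A x - pderiv m B x.
Proof. by move=> SA SB Ux; rewrite /pderiv deriveB//; exact: smooth_mx_derivable. Qed.

Lemma pderiv_scalemx p q m f (A : E -> 'M[R]_(p.+1, q.+1)) x :
  smooth U f -> smooth U A -> U x ->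
  pderiv m (fun y => f y *: A y) x = pderiv m f x *: A x + f x *: pderiv m A x.
Proof.
move=> Sf SA Ux; apply/matrixP => i j; rewrite pderiv_mxE //; last exact: smooth_scalemx.
rewrite !mxE pderiv_mxE // -pderivM //; last exact: (smooth_mxP A).1.
by apply: (pderiv_eq m oU Ux) => y _; rewrite mxE.
Qed.

Lemma pderiv_exp m f x : smooth U f -> U x ->
  pderiv m (fun y => expR (f y) : R^o) x = expR (f x) * pderiv m f x.
Proof.
move=> Sf Ux; rewrite /pderiv; apply: derive_val; apply: is_derive_comp1.
exact: smooth_derivable.
Qed.

Lemma pderiv_mxC p q m n (F : E -> 'M[R]_(p.+1, q.+1)) x : smooth U F -> U x ->
  pderiv m (pderiv n F) x = pderiv n (pderiv m F) x.
Proof.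
move=> SF Ux; apply/matrixP => i j.
have E1 k l : pderiv k (pderiv l F) x i j =
    pderiv k (pderiv l (fun y => F y i j : R^o)) x.
  rewrite (pderiv_mxE k i j (smooth_mx_pderiv l SF) Ux).
  by apply: (pderiv_eq k oU Ux) => y Uy; exact: pderiv_mxE.
have Sij := (smooth_mxP F).1 SF i j.
exact: (etrans (E1 m n) (etrans (pderivC m n oU (Sij 2) Ux) (esym (E1 n m)))).
Qed.
End smooth_fields.

(** * The Levi-Civita connection on 2-forms *)

Section levicivita.
Variables (R : realType) (U : set 'rV[R]_4) (g : 'rV[R]_4 -> 'M[R]_4).
Hypotheses (oU : open U) (Sg : smooth U g) (gip : forall x, U x -> inner_product (g x)).
Notation E := 'rV[R]_4.
Implicit Types (x : E) (l m n p q : 'I_4).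

(** The endomorphism nabla_m - d_m of the tangent space.  Matrices turn the
    identities of tensor calculus into noncommutative algebra. *)
Definition christoffel_mx m x : 'M[R]_4 := \matrix_(l, p) christoffel g l m p x.

Definition curvature_mx m n x : 'M[R]_4 := \matrix_(l, p) riemann g l p m n x.

Lemma entryD (A B : 'M[R]_4) i j : (A + B) i j = A i j + B i j.
Proof. exact: mxE. Qed.

Lemma entryN (A : 'M[R]_4) i j : (- A) i j = - A i j.
Proof. exact: mxE. Qed.

Lemma smooth_metric_entry i j : smooth U (fun y => g y i j : R^o).
Proof. exact: (smooth_mxP oU g).1. Qed.

Lemma pderiv_metric_sym m i j x : U x ->
  pderiv m (fun y => g y i j : R^o) x = pderiv m (fun y => g y j i : R^o) x.
Proof.
by move=> Ux; apply: (pderiv_eq m oU Ux) => y Uy; exact: (metric_sym_entry (gip Uy)).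
Qed.

Lemma smooth_invmetric : smooth U (fun y => invmx (g y)).
Proof. by apply: smooth_invmx => // x Ux; exact: (det_metric_gt0 (gip Ux)). Qed.

Lemma smooth_christoffel m : smooth U (christoffel_mx m).
Proof.
apply/smooth_mxP => // l p.
have S : smooth U (fun x => 2^-1 * \sum_(r < 4) invmx (g x) l r *
    (pderiv m (fun y => g y r p : R^o) x + pderiv p (fun y => g y r m : R^o) x
     - pderiv r (fun y => g y m p : R^o) x) : R^o).
  apply: smoothM => //; first exact: smooth_cst.
  apply: smooth_sum => // r; apply: smoothM => //;
    first exact: (smooth_mxP oU _).1 smooth_invmetric l r.
  have d k i j : smooth U (pderiv k (fun y => g y i j : R^o)) by apply: smooth_pderiv;
    exact: smooth_metric_entry.
  by apply: smoothB => //; apply: smoothD.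
by apply: (smooth_eq oU _ S) => y _; rewrite mxE.
Qed.

Lemma lower_christoffel m x q p : U x -> (g x *m christoffel_mx m x) q p =
  2^-1 * (pderiv m (fun y => g y q p : R^o) x + pderiv p (fun y => g y q m : R^o) x
          - pderiv q (fun y => g y m p : R^o) x).
Proof.
move=> Ux; set D := fun r => pderiv m (fun y => g y r p : R^o) x
  + pderiv p (fun y => g y r m : R^o) x - pderiv r (fun y => g y m p : R^o) x.
have -> : christoffel_mx m x = invmx (g x) *m (2^-1 *: \matrix_(r, p) (
    pderiv m (fun y => g y r p : R^o) x + pderiv p (fun y => g y r m : R^o) x
     - pderiv r (fun y => g y m p : R^o) x)).
  apply/matrixP => l k; rewrite mxE [RHS]mxE /christoffel mulr_sumr.
  by apply: eq_bigr => r _; rewrite [in RHS]mxE [X in _ = _ * (_ * X)]mxE mulrCA.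
by rewrite mulmxA mulmxV ?(metric_unit (gip Ux))// mul1mx mxE [X in _ * X]mxE.
Qed.

Lemma christoffel_sym m p l x : U x -> christoffel_mx m x l p = christoffel_mx p x l m.
Proof.
move=> Ux; rewrite !mxE /christoffel; congr (_ * _); apply: eq_bigr => r _.
congr (_ * _); rewrite (pderiv_metric_sym r m p Ux); ring.
Qed.

Lemma metric_compat m x : U x ->
  pderiv m g x = (christoffel_mx m x)^T *m g x + g x *m christoffel_mx m x.
Proof.
move=> Ux; apply/matrixP => q p.
have gT : (christoffel_mx m x)^T *m g x = (g x *m christoffel_mx m x)^T.
  by rewrite trmx_mul; have [-> _] := gip Ux.
rewrite (pderiv_mxE m q p Sg Ux) gT [RHS]mxE [X in X + _]mxE !lower_christoffel //.
by rewrite (pderiv_metric_sym m p q Ux) (pderiv_metric_sym q m p Ux) (pderiv_metric_sym p q m Ux);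
  field.
Qed.

Lemma LeviCivitaE m v x :
  LeviCivita g m v x = pderiv m v x - (christoffel_mx m x)^T *m v x - v x *m christoffel_mx m x.
Proof.
apply/matrixP => p q; rewrite !mxE; congr (_ - _ - _).
  by apply: eq_bigr => l _; rewrite !mxE.
by apply: eq_bigr => l _; rewrite !mxE mulrC.
Qed.

Lemma LeviCivita_smooth m v : smooth U v -> smooth U (LeviCivita g m v).
Proof.
move=> Sv; have -> : LeviCivita g m v = fun x =>
  pderiv m v x - (christoffel_mx m x)^T *m v x - v x *m christoffel_mx m x.
  by apply/funext => x; exact: LeviCivitaE.
have Sc := smooth_christoffel m; apply: smooth_mxB => //; last exact: smooth_mulmx.
apply: smooth_mxB => //; first exact: smooth_mx_pderiv.
by apply: smooth_mulmx => //; exact: smooth_trmx.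
Qed.

Lemma curvature_mxE m n x : U x -> curvature_mx m n x =
  pderiv m (christoffel_mx n) x - pderiv n (christoffel_mx m) x +
    (christoffel_mx m x *m christoffel_mx n x - christoffel_mx n x *m christoffel_mx m x).
Proof.
move=> Ux; apply/matrixP => l p; rewrite [LHS]mxE /riemann.
have D k q : pderiv k (christoffel g l q p : _ -> R^o) x = pderiv k (christoffel_mx q) x l p.
  apply: etrans (esym (pderiv_mxE k l p (smooth_christoffel q) Ux)).
  by apply: (pderiv_eq k oU Ux) => y _; rewrite mxE.
rewrite entryD entryD entryN entryD entryN; congr (_ + _).
  by congr (_ - _); exact: D.
rewrite [X in _ = X + _]mxE [X in _ = _ - X]mxE -sumrB.
by apply: eq_bigr => r _; rewrite !mxE.
Qed.

(** The derivatives of v cancel, by the symmetry of second derivatives and of the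
    mixed terms; what remains is the curvature acting on the two indices of v. *)
Lemma ricci_identity m n v x : smooth U v -> U x ->
  LeviCivita g m (LeviCivita g n v) x - LeviCivita g n (LeviCivita g m v) x =
  - (curvature_mx m n x)^T *m v x - v x *m curvature_mx m n x.
Proof.
move=> Sv Ux.
have D k l : pderiv k (LeviCivita g l v) x = pderiv k (pderiv l v) x
    - ((pderiv k (christoffel_mx l) x)^T *m v x + (christoffel_mx l x)^T *m pderiv k v x)
    - (pderiv k v x *m christoffel_mx l x + v x *m pderiv k (christoffel_mx l) x).
  have -> : LeviCivita g l v = fun x =>
    pderiv l v x - (christoffel_mx l x)^T *m v x - v x *m christoffel_mx l x.
    by apply/funext => y; exact: LeviCivitaE.
  have Sc := smooth_christoffel l; have Sct := smooth_trmx oU Sc.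
  rewrite (pderiv_mxB k (smooth_mxB oU (smooth_mx_pderiv l Sv) (smooth_mulmx oU Sct Sv))
    (smooth_mulmx oU Sv Sc) Ux).
  rewrite (pderiv_mxB k (smooth_mx_pderiv l Sv) (smooth_mulmx oU Sct Sv) Ux).
  by rewrite (pderiv_mulmx oU k Sct Sv Ux) (pderiv_mulmx oU k Sv Sc Ux) (pderiv_trmx oU k Sc Ux).
rewrite (LeviCivitaE m (LeviCivita g n v)) (LeviCivitaE n (LeviCivita g m v)) !D.
rewrite (pderiv_mxC oU m n Sv Ux) (LeviCivitaE n v) (LeviCivitaE m v) curvature_mxE //.
move: (pderiv m (christoffel_mx n) x) (pderiv n (christoffel_mx m) x) (pderiv m v x) (pderiv n v x).
move: (pderiv n (pderiv m v) x) (christoffel_mx m x) (christoffel_mx n x) (v x) =>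
  vmn a b u am bn um un.
have trD (A B : 'M[R]_4) : (A + B)^T = A^T + B^T by exact: raddfD.
have trN (A : 'M[R]_4) : (- A)^T = - A^T by exact: raddfN.
rewrite !(trD, trN, trmx_mul).
rewrite !(mulmxDl, mulmxDr, mulNmx, mulmxN, opprD, opprK, mulmxA).
apply/matrixP => i j; rewrite !(entryD, entryN); ring.
Qed.

End levicivita.

Lemma setrowE (R : realType) n (A : 'M[R]_n) k v i j :
  setrow A k v i j = if i == k then v j else A i j.
Proof. exact: mxE. Qed.

(** * Parallel tensors *)

Section parallel.
Variables (R : realType) (U : set 'rV[R]_4) (g : 'rV[R]_4 -> 'M[R]_4).
Hypotheses (oU : open U) (Sg : smooth U g) (gip : forall x, U x -> inner_product (g x)).
Notation E := 'rV[R]_4.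
Implicit Types (x : E) (l m n p q : 'I_4).
Let chr := christoffel_mx g.
Let riem := curvature_mx g.

Lemma curvature_mx_anti m n x : riem n m x = - riem m n x.
Proof.
apply/matrixP => l p; rewrite mxE [RHS]mxE [X in - X]mxE /riemann opprD opprB -sumrN.
by congr (_ + _); apply: eq_bigr => r _; rewrite opprB.
Qed.

(** The Ricci identity holds for arbitrary matrix fields; for the parallel field g
    its left-hand side vanishes. *)
Lemma curvature_mx_skew m n x : U x -> (riem m n x)^T *m g x = - (g x *m riem m n x).
Proof.
move=> Ux; have := ricci_identity oU Sg gip m n Sg Ux.
have LC0 k y : U y -> LeviCivita g k g y = 0.
  by move=> Uy; rewrite LeviCivitaE (metric_compat oU Sg gip k Uy) addrAC addrK subrr.
have P0 k l : LeviCivita g k (LeviCivita g l g) x = 0.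
  rewrite LeviCivitaE LC0 // mulmx0 mul0mx !subr0.
  apply: etrans (derive_cst (0 : 'M[R]_4) x (delta_mx 0 k)).
  by apply: (pderiv_eq k oU Ux) => y Uy; exact: LC0.
by rewrite !P0 subrr mulNmx => /eqP; rewrite eq_sym addr_eq0 opprK => /eqP <-; rewrite opprK.
Qed.

Lemma bianchi m n p l x : U x ->
  riem m n x l p + riem n p x l m + riem p m x l n = 0.
Proof.
move=> Ux; pose d a b c := pderiv a (christoffel g l b c : _ -> R^o) x.
pose s a b c := \sum_(r < 4) (christoffel g l a r x * christoffel g r b c x
                - christoffel g l b r x * christoffel g r a c x).
have E a b c : riem a b x l c = d a b c - d b a c + s a b c by rewrite mxE.
have cs k a b y : U y -> christoffel g k a b y = christoffel g k b a y.
  by move=> Uy; have := christoffel_sym oU gip a b k Uy; rewrite mxE [RHS]mxE.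
have dC a b c : d a b c = d a c b.
  by apply: (pderiv_eq a oU Ux) => y Uy; exact: cs.
have s0 : s m n p + s n p m + s p m n = 0.
  rewrite -!big_split /= big1 // => r _.
  have := cs r p n x Ux; have := cs r p m x Ux; have := cs r n m x Ux.
  move: (christoffel g) => G -> -> ->; ring.
clearbody d s; rewrite (E m n p) (E n p m) (E p m n) (dC m n p) (dC n p m) (dC p m n); lra.
Qed.

(** Jacobi's formula, in which the metric compatibility of the connection produces
    two equal traces. *)
Lemma pderiv_det m x : U x ->
  pderiv m (fun y => \det (g y) : R^o) x = 2 * \tr (chr m x) * \det (g x).
Proof.
move=> Ux; pose r k (k4 : (k < 4)%N) := Ordinal k4.
have S i j : smooth U (fun y => g y i j : R^o) by exact: smooth_metric_entry.
have D : pderiv m (fun y => \det (g y) : R^o) x =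
    \sum_k \det (setrow (g x) k (fun j => pderiv m g x k j)).
  pose F (y : E) a b c d : R := g y (@r 0 isT) a * g y (@r 1 isT) b * g y (@r 2 isT) c * g y (@r 3
    isT) d
    * levi_civita R [tuple a; b; c; d].
  have F1 a b c d : smooth U (fun y => F y a b c d : R^o).
    apply: smoothM => //; last exact: smooth_cst.
    by do !apply: smoothM => //.
  have F2 a b c : smooth U (fun y => \sum_d F y a b c d : R^o) by apply: smooth_sum.
  have F3 a b : smooth U (fun y => \sum_c \sum_d F y a b c d : R^o) by apply: smooth_sum.
  have F4 a : smooth U (fun y => \sum_b \sum_c \sum_d F y a b c d : R^o) by apply: smooth_sum.
  transitivity (pderiv m (fun y => \sum_a \sum_b \sum_c \sum_d F y a b c d : R^o) x).
    by apply: (pderiv_eq m oU Ux) => y _; rewrite det4_levi.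
  rewrite (pderiv_sum oU _ _ F4 Ux) [RHS]sum4 !det4_levi -!big_split /=; apply: eq_bigr => a _.
  rewrite (pderiv_sum oU _ _ (F3 a) Ux) -!big_split /=; apply: eq_bigr => b _.
  rewrite (pderiv_sum oU _ _ (F2 a b) Ux) -!big_split /=; apply: eq_bigr => c _.
  rewrite (pderiv_sum oU _ _ (F1 a b c) Ux) -!big_split /=; apply: eq_bigr => d _.
  rewrite (pderivM m (smoothM oU (smoothM oU (smoothM oU (S _ a) (S _ b)) (S _ c)) (S _ d))
    (smooth_cst U _) Ux).
  rewrite (pderivM m (smoothM oU (smoothM oU (S _ a) (S _ b)) (S _ c)) (S _ d) Ux).
  rewrite (pderivM m (smoothM oU (S _ a) (S _ b)) (S _ c) Ux) (pderivM m (S _ a) (S _ b) Ux).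
  rewrite [pderiv m (fun _ => levi_civita _ _) x](derive_cst (levi_civita R [tuple a; b; c; d] :
    R^o)).
  rewrite !setrowE /= !(pderiv_mxE m _ _ Sg Ux) /r mulr0 addr0.
  ring.
have gadj : (chr m x)^T *m g x = (g x *m chr m x)^T.
  by rewrite trmx_mul; have [-> _] := gip Ux.
rewrite D sum_det_setrow (metric_compat oU Sg gip m Ux) gadj mulmxDl linearD /=.
rewrite tr_mul_adj -[in X in X + _]mxtrace_tr trmx_mul trmxK.
have -> : (\adj (g x))^T = \adj (g x).
  by apply/matrixP => i j; rewrite !mxE -cofactor_tr; have [-> _] := gip Ux.
by rewrite mxtrace_mulC tr_mul_adj; ring.
Qed.

Let vol (y : E) : R^o := Num.sqrt (\det (g y)).

Lemma smooth_det_metric : smooth U (fun y => \det (g y) : R^o).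
Proof. by apply: smooth_det => // i j; exact: smooth_metric_entry. Qed.

Lemma smooth_vol : smooth U vol.
Proof. by apply: smooth_sqrt => //; [move=> y Uy;
  exact: (det_metric_gt0 (gip Uy)) | exact: smooth_det_metric]. Qed.

Lemma pderiv_vol m x : U x -> pderiv m vol x = \tr (chr m x) * vol x.
Proof.
move=> Ux; have d0 := det_metric_gt0 (gip Ux).
have vv y : U y -> vol y * vol y = \det (g y).
  by move=> Uy; rewrite -expr2 sqr_sqrtr// ltW// (det_metric_gt0 (gip Uy)).
have : pderiv m (fun y => vol y * vol y : R^o) x = 2 * \tr (chr m x) * \det (g x).
  by rewrite -pderiv_det //; apply: (pderiv_eq m oU Ux) => y; exact: vv.
rewrite (pderivM m smooth_vol smooth_vol Ux) -(vv x Ux).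
have v0 : vol x != 0 by rewrite /vol gt_eqF// sqrtr_gt0.
move: (pderiv m vol x) (vol x) v0 (\tr (chr m x)) => d v v0 t dE.
by apply: (mulIf v0); lra.
Qed.

Lemma Kern_volE y p q m n : U y -> Kern (g y) p q m n =
  2^-1 * (g y m p * g y n q - g y m q * g y n p + vol y * levi_civita R [tuple m; n; p; q]).
Proof. by move=> Uy; exact: KernE (gip Uy) p q m n. Qed.

Lemma smooth_Kern p q : smooth U (fun y => Kern (g y) p q).
Proof.
apply/smooth_mxP => // m n.
have S i j : smooth U (fun y => g y i j : R^o) by exact: smooth_metric_entry.
have : smooth U (fun y => 2^-1 * (g y m p * g y n q - g y m q * g y n p
    + vol y * levi_civita R [tuple m; n; p; q]) : R^o).
  apply: smoothM => //; first exact: smooth_cst.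
  apply: smoothD => //; first by apply: smoothB => //; exact: smoothM.
  by apply: smoothM => //; [exact: smooth_vol | exact: smooth_cst].
by move=> /(smooth_eq oU); apply=> y Uy; rewrite Kern_volE.
Qed.

Lemma pderiv_metric k i j x : U x -> pderiv k (fun y => g y i j : R^o) x =
  \sum_l (chr k x l i * g x l j + chr k x l j * g x i l).
Proof.
move=> Ux; rewrite -(pderiv_mxE k i j Sg Ux) (metric_compat oU Sg gip k Ux) entryD.
rewrite mxE [X in _ + X]mxE big_split /=; congr (_ + _); apply: eq_bigr => l _.
  by rewrite [X in X * _]mxE.
exact: mulrC.
Qed.

(** The left-hand side is the covariant derivative in the slots m and n of the
    kernel K, computed with nabla g = 0 and nabla vol = 0.  As K is built from g
    and vol, its derivative in all four slots vanishes; the terms of the slots p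
    and q are the right-hand side. *)
Lemma kernel_derivation (C G : 'M[R]_4) (v : R) m n p q :
  let K a b c d : R := 2^-1 * (G a c * G b d - G a d * G b c
                                + v * levi_civita R [tuple a; b; c; d]) in
  2^-1 * ((\sum_l (C l m * G l p + C l p * G m l)) * G n q
          + G m p * (\sum_l (C l n * G l q + C l q * G n l))
          - ((\sum_l (C l m * G l q + C l q * G m l)) * G n p
             + G m q * (\sum_l (C l n * G l p + C l p * G n l)))
          + \tr C * v * levi_civita R [tuple m; n; p; q])
  - \sum_l C l m * K l n p q - \sum_l K m l p q * C l n =
  \sum_l (C l p * K m n l q + C l q * K m n p l).
Proof.
move=> K; rewrite -mulrA mulrCA -levi_derivation !sum4 /K.
by field.
Qed.

Lemma LeviCivita_Kern k p q x : U x ->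
  LeviCivita g k (fun y => Kern (g y) p q) x =
  \sum_l (chr k x l p *: Kern (g x) l q + chr k x l q *: Kern (g x) p l).
Proof.
move=> Ux; rewrite LeviCivitaE; apply/matrixP => m n.
rewrite entryD entryD !entryN (pderiv_mxE k m n (smooth_Kern p q) Ux) summxE.
have S i j : smooth U (fun y => g y i j : R^o) by exact: smooth_metric_entry.
have -> : pderiv k (fun y => Kern (g y) p q m n : R^o) x = 2^-1 * (
   (pderiv k (fun y => g y m p : R^o) x * g x n q + g x m p * pderiv k (fun y => g y n q : R^o) x)
   - (pderiv k (fun y => g y m q : R^o) x * g x n p + g x m q * pderiv k (fun y => g y n p : R^o) x)
   + \tr (chr k x) * vol x * levi_civita R [tuple m; n; p; q]).
  pose a y : R^o := g y m p * g y n q - g y m q * g y n p.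
  pose b y : R^o := vol y * levi_civita R [tuple m; n; p; q].
  have Sa : smooth U a by apply: smoothB => //; exact: smoothM.
  have Sb : smooth U b by apply: smoothM => //; [exact: smooth_vol | exact: smooth_cst].
  transitivity (pderiv k (fun y => 2^-1 * (a y + b y) : R^o) x).
    by apply: (pderiv_eq k oU Ux) => y Uy; rewrite Kern_volE.
  rewrite (pderivZ k _ (smoothD oU Sa Sb) Ux) (pderivD k Sa Sb Ux); congr (_ * (_ + _)).
    rewrite /a -(pderivM k (S m p) (S n q) Ux) -(pderivM k (S m q) (S n p) Ux).
    rewrite /pderiv deriveB //; exact: smooth_derivable (smoothM oU (S _ _) (S _ _)) Ux.
  rewrite /b (pderivM k smooth_vol (smooth_cst U _) Ux) (pderiv_vol k Ux).
  by rewrite [pderiv k (fun _ => _) x](derive_cst (levi_civita R [tuple m; n; p; q] :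
    R^o)) mulr0 addr0.
rewrite !pderiv_metric // [X in _ - X - _]mxE [X in _ - _ - X]mxE.
under [X in _ - X - _]eq_bigr do rewrite Kern_volE // [X in X * _]mxE.
under [X in _ - _ - X]eq_bigr do rewrite Kern_volE //.
rewrite kernel_derivation; apply: eq_bigr => l _; rewrite entryD.
by rewrite [X in _ = X + _]mxE [X in _ = _ + X]mxE !Kern_volE.
Qed.

(** As the tensor K is parallel, only Christoffel symbols remain, and these cancel
    in the cyclic sum by their symmetry. *)
Lemma torsion_Kern m n p x : U x -> d2 (LeviCivita g) (fun n p y => Kern (g y) n p) m n p x = 0.
Proof.
move=> Ux; rewrite /d2 !LeviCivita_Kern // -!big_split /=.
have Ksk := Kern_anti (g x).
apply: big1 => l _.
have cs a b : chr a x l b = chr b x l a := christoffel_sym oU gip a b l Ux.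
have [c1 c2 c3] := And3 (cs n m) (cs p m) (cs p n).
rewrite [chr n x l m]c1 [chr p x l m]c2 [chr p x l n]c3 (Ksk l m) (Ksk l n) (Ksk l p).
move: (Kern (g x)) (chr m x l p) (chr m x l n) (chr n x l p) => K u v w; apply/matrixP => a b;
  rewrite !mxE; ring.
Qed.

End parallel.

Section lc_sections.
Variables (R : realType) (U : set 'rV[R]_4) (g : 'rV[R]_4 -> 'M[R]_4).
Hypotheses (oU : open U) (Sg : smooth U g) (gip : forall x, U x -> inner_product (g x)).
Notation E := 'rV[R]_4.
Implicit Types (x : E) (l m n p q : 'I_4).

Lemma LeviCivita_eq m (u v : E -> 'M[R]_4) x : U x -> (forall y, U y -> u y = v y) ->
  LeviCivita g m u x = LeviCivita g m v x.
Proof. by move=> Ux uv; rewrite !LeviCivitaE (pderiv_eq m oU Ux uv) uv. Qed.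

Lemma LeviCivita_scale m (f : E -> R^o) (v : E -> 'M[R]_4) x :
  smooth U f -> smooth U v -> U x ->
  LeviCivita g m (fun y => f y *: v y) x = pderiv m f x *: v x + f x *: LeviCivita g m v x.
Proof.
move=> Sf Sv Ux; rewrite !LeviCivitaE (pderiv_scalemx oU m Sf Sv Ux).
by rewrite -scalemxAr -scalemxAl !scalerBr !addrA.
Qed.

Lemma LeviCivitaD m (u v : E -> 'M[R]_4) x : smooth U u -> smooth U v -> U x ->
  LeviCivita g m (fun y => u y + v y) x = LeviCivita g m u x + LeviCivita g m v x.
Proof.
move=> Su Sv Ux; rewrite !LeviCivitaE.
have -> : pderiv m (fun y => u y + v y) x = pderiv m u x + pderiv m v x.
  by rewrite /pderiv deriveD//; apply: smooth_mx_derivable Ux.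
rewrite mulmxDr mulmxDl !opprD !addrA.
move: (pderiv m u x) (pderiv m v x) (_^T *m u x) (_^T *m v x) (u x *m _) (v x *m _).
by move=> a b c d e f; apply/matrixP => i j; rewrite !(entryD, entryN); ring.
Qed.

Lemma LeviCivita0 m x : LeviCivita g m (fun=> 0) x = 0.
Proof.
rewrite LeviCivitaE mulmx0 mul0mx !subr0.
exact: (derive_cst (0 : 'M[R]_4) x (delta_mx 0 m)).
Qed.

Lemma smooth_mx_sum I (r : seq I) (F : I -> E -> 'M[R]_4) :
  (forall i, smooth U (F i)) -> smooth U (fun y => \sum_(i <- r) F i y).
Proof.
move=> SF; apply/smooth_mxP => // i j.
have S : smooth U (fun y => \sum_(k <- r) F k y i j : R^o).
  by apply: smooth_sum => // k; exact: (smooth_mxP oU _).1.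
by apply: (smooth_eq oU) S => y _; rewrite summxE.
Qed.

Lemma LeviCivita_sum m I (r : seq I) (F : I -> E -> 'M[R]_4) x :
  (forall i, smooth U (F i)) -> U x ->
  LeviCivita g m (fun y => \sum_(i <- r) F i y) x = \sum_(i <- r) LeviCivita g m (F i) x.
Proof.
move=> SF Ux; elim: r => [|i r IH].
  rewrite big_nil -[RHS](LeviCivita0 m x).
  by apply: LeviCivita_eq => // y _; rewrite big_nil.
rewrite big_cons -IH -LeviCivitaD //; last exact: smooth_mx_sum.
by apply: LeviCivita_eq => // y _; rewrite big_cons.
Qed.

(** By [Kern_span] the section is a combination, with smooth coefficients, of the
    kernel sections, whose derivatives are known from [LeviCivita_Kern]. *)
Lemma Lplus_LeviCivita m v x : section_of_Lplus U g v -> U x ->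
  Lplus (g x) (LeviCivita g m v x).
Proof.
move=> [Sv Lv] Ux.
pose w p q y : R^o := 2^-1 * sharp (g y) (v y) p q.
have Sw p q : smooth U (w p q).
  apply: smoothM => //; first exact: smooth_cst.
  have Si := smooth_invmetric oU Sg gip.
  exact: (smooth_mxP oU _).1 (smooth_mulmx oU (smooth_mulmx oU Si Sv) Si) p q.
have SK p q := smooth_Kern oU Sg gip p q.
have SwK p q : smooth U (fun y => w p q y *: Kern (g y) p q) by exact: smooth_scalemx.
have -> : LeviCivita g m v x = \sum_p \sum_q LeviCivita g m (fun y => w p q y *: Kern (g y) p q) x.
  transitivity (LeviCivita g m (fun y => \sum_p \sum_q w p q y *: Kern (g y) p q) x).
    apply: LeviCivita_eq => // y Uy; exact: (Kern_span (gip Uy) (Lv y Uy)).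
  rewrite LeviCivita_sum // => [|p]; last exact: smooth_mx_sum.
  by apply: eq_bigr => p _; rewrite LeviCivita_sum.
have gx := gip Ux.
apply: Lplus_sum => // p; apply: Lplus_sum => // q.
rewrite LeviCivita_scale // (LeviCivita_Kern oU Sg gip m p q Ux); apply: LplusD => //.
  by apply: LplusZ => //; exact: Lplus_Kern.
apply: LplusZ => //; apply: Lplus_sum => // l.
by apply: LplusD => //; apply: LplusZ => //; exact: Lplus_Kern.
Qed.

End lc_sections.

(** * Conformal change of the metric *)

Section conformal_algebra.
Variables (R : realType) (G : 'M[R]_4) (c : R).
Hypotheses (Gip : inner_product G) (c0 : 0 < c).

Lemma inner_product_conf : inner_product (c *: G).
Proof.
have [GT pos] := Gip; split; first by rewrite linearZ /= GT.
by move=> v v0; rewrite -scalemxAr -scalemxAl mxE mulr_gt0 // pos.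
Qed.

Lemma invmx_conf : invmx (c *: G) = c^-1 *: invmx G.
Proof.
have cG : c *: G \in unitmx by apply: metric_unit; exact: inner_product_conf.
by rewrite invmxZ.
Qed.

Lemma vol_conf : Num.sqrt (\det (c *: G)) = c ^+ 2 * Num.sqrt (\det G).
Proof.
by rewrite detZ (exprM c 2 2) sqrtrM ?sqr_ge0// sqrtr_sqr ger0_norm// sqr_ge0.
Qed.

(** In dimension four the volume form contributes c^2, and raising two indices
    contributes c^-2. *)
Lemma hodge_conf (V : lmodType R) (b : 'I_4 -> 'I_4 -> V) m n :
  hodge (c *: G) b m n = hodge G b m n.
Proof.
apply: eq_bigr => p _; apply: eq_bigr => q _; congr (_ *: _).
have -> : \sum_r \sum_u levi_civita R [tuple m; n; r; u] * invmx (c *: G) r p * invmx (c *: G) u q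
    = c^-2 * \sum_r \sum_u levi_civita R [tuple m; n; r; u] * invmx G r p * invmx G u q.
  rewrite mulr_sumr; apply: eq_bigr => r _; rewrite mulr_sumr; apply: eq_bigr => u _.
  by rewrite invmx_conf !mxE; field; rewrite gt_eqF.
by rewrite vol_conf; field; rewrite gt_eqF.
Qed.

Lemma Lplus_conf s : Lplus (c *: G) s <-> Lplus G s.
Proof. by split=> -[sT sh]; split=> // m n; have := sh m n; rewrite hodge_conf. Qed.

Lemma Kern_conf p q : Kern (c *: G) p q = c ^+ 2 *: Kern G p q.
Proof.
apply/matrixP => m n; rewrite [RHS]mxE.
rewrite !KernE //; last exact: inner_product_conf.
by rewrite vol_conf !mxE; ring.
Qed.

Lemma ip2_conf s t : ip2 (c *: G) s t = c^-2 * ip2 G s t.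
Proof.
rewrite /ip2 invmx_conf mulrCA; congr (_ * _).
do 4!(rewrite mulr_sumr; apply: eq_bigr => ? _).
by rewrite !mxE -exprVn; ring.
Qed.

Lemma proj_conf s : s^T = - s -> proj (c *: G) s = proj G s.
Proof.
move=> sT; apply/matrixP => m n; have cip := inner_product_conf.
by rewrite -!sd_part_proj // /sd_part hodge_conf.
Qed.
End conformal_algebra.

Section conformal_change.
Variables (R : realType) (U : set 'rV[R]_4) (g : 'rV[R]_4 -> 'M[R]_4) (f : 'rV[R]_4 -> R^o).
Hypotheses (oU : open U) (Sg : smooth U g) (gip : forall x, U x -> inner_product (g x)).
Hypothesis (Sf : smooth U f).
Notation E := 'rV[R]_4.
Implicit Types (x : E) (l m n p q : 'I_4).

Let e (y : E) : R^o := expR (2 * f y).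
Let gh (y : E) : 'M[R]_4 := e y *: g y.

Lemma conf_factor_gt0 y : 0 < e y. Proof. exact: expR_gt0. Qed.

Lemma smooth_conf_factor : smooth U e.
Proof. by apply: smooth_exp => //; apply: smoothM => //; exact: smooth_cst. Qed.

Lemma smooth_conf_metric : smooth U gh.
Proof. by apply: smooth_scalemx => //; exact: smooth_conf_factor. Qed.

Lemma inner_product_conf_metric x : U x -> inner_product (gh x).
Proof. by move=> Ux; apply: inner_product_conf (gip Ux) (conf_factor_gt0 x). Qed.

Lemma pderiv_conf_factor m x : U x -> pderiv m e x = 2 * pderiv m f x * e x.
Proof.
move=> Ux; rewrite (pderiv_exp m (smoothM oU (smooth_cst U 2) Sf) Ux) (pderivZ m 2 Sf Ux).
exact: mulrC.
Qed.

(** The 2-form e_m /\ df, where e_m is the coordinate vector field as a 1-form: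
    the skew part of the change of the Levi-Civita connection. *)
Definition tilt m x : 'M[R]_4 :=
  \matrix_(p, l) (g x m p * pderiv l f x - pderiv p f x * g x m l).

Lemma tilt_skew m x : (tilt m x)^T = - tilt m x.
Proof. by apply/matrixP => p l; rewrite !mxE; ring. Qed.

Lemma christoffel_conf m x : U x ->
  christoffel_mx gh m x = christoffel_mx g m x + (pderiv m f x)%:M + invmx (g x) *m tilt m x.
Proof.
move=> Ux; have gu := metric_unit (gip Ux); have e0 : e x != 0 by rewrite gt_eqF ?conf_factor_gt0.
suff H : g x *m christoffel_mx gh m x =
  g x *m christoffel_mx g m x + pderiv m f x *: g x + tilt m x.
  apply: (can_inj (mulKmx gu)); rewrite H !mulmxDr mulmxA mulmxV // mul1mx.
  by rewrite mul_mx_scalar.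
have Dgh k i j : pderiv k (fun y => gh y i j : R^o) x =
    e x * (2 * pderiv k f x * g x i j + pderiv k (fun y => g y i j : R^o) x).
  have S : smooth U (fun y => g y i j : R^o) by exact: smooth_metric_entry.
  rewrite -(pderiv_mxE k i j smooth_conf_metric Ux) (pderiv_scalemx oU k smooth_conf_factor Sg Ux)
    mxE.
  rewrite mxE [X in _ + X]mxE (pderiv_mxE k i j Sg Ux) (pderiv_conf_factor k Ux).
  by ring.
apply: (scalerI e0); rewrite scalemxAl.
apply/matrixP => q p; rewrite (lower_christoffel inner_product_conf_metric m q p Ux) !Dgh.
rewrite [RHS]mxE entryD entryD (lower_christoffel gip m q p Ux) [X in _ =
  _ * (_ + X + _)]mxE [X in _ = _ * (_ + X)]mxE.
rewrite (metric_sym_entry (gip Ux) q m).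
move: (pderiv m f x) (pderiv p f x) (pderiv q f x) (pderiv m _ x) (pderiv p _ x) (pderiv q _ x).
by move=> *; field.
Qed.

(** The scalar part of [christoffel_conf], once for each index of v, cancels the
    derivative of the factor; the skew part acts on v by [cross_skew]. *)
Lemma LeviCivita_conf m v x : section_of_Lplus U g v -> U x ->
  LeviCivita gh m (fun y => e y *: v y) x =
  e x *: (LeviCivita g m v x + Num.sqrt 2 *: cross (g x) (tilt m x) (v x)).
Proof.
move=> [Sv Lv] Ux; rewrite (cross_skew (gip Ux) (tilt_skew m x) (Lv x Ux)).
rewrite !LeviCivitaE (pderiv_scalemx oU m smooth_conf_factor Sv Ux) (pderiv_conf_factor m Ux)
  (christoffel_conf m Ux).
have trE : (christoffel_mx g m x + (pderiv m f x)%:M + invmx (g x) *m tilt m x)^T =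
    (christoffel_mx g m x)^T + (pderiv m f x)%:M - tilt m x *m invmx (g x).
  rewrite -mulNmx -tilt_skew -{2}(invmetric_tr (gip Ux)) -trmx_mul.
  have trD (A B : 'M[R]_4) : (A + B)^T = A^T + B^T by exact: raddfD.
  by rewrite !trD tr_scalar_mx.
rewrite trE.
move: (pderiv m f x) (pderiv m v x) (christoffel_mx g m x) (tilt m x) (invmx (g x)) (v x) (e x) =>
  a b C N I u k.
rewrite !(mulmxDl, mulmxDr, mulNmx, mulmxA) -!scalemxAr -!scalemxAl !mul_scalar_mx !mul_mx_scalar.
rewrite ?(mulmxDl, mulmxDr, mulNmx, mulmxA) ?mul_scalar_mx ?mul_mx_scalar.
move: (C^T *m u) (u *m C) (N *m I *m u) (u *m I *m N) => p q r s.
by apply/matrixP => i j; rewrite !mxE; ring.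
Qed.

(** The difference between the transported Levi-Civita connection of the
    conformal metric and the one of g. *)
Let alpha m x : 'M[R]_4 := Num.sqrt 2 *: proj (g x) (tilt m x).

Lemma Lplus_alpha m x : U x -> Lplus (g x) (alpha m x).
Proof. by move=> Ux; apply: LplusZ; [exact: gip | apply: Lplus_proj; exact: gip]. Qed.

Lemma cross_alpha m x v : U x ->
  cross (g x) (alpha m x) v = Num.sqrt 2 *: cross (g x) (tilt m x) v.
Proof. by move=> Ux; rewrite crossZl ?cross_proj //; exact: gip. Qed.

Let h (y : E) (s : 'M[R]_4) : 'M[R]_4 := expR (2 * f y) *: s.

Lemma Bfield_conf n p y : U y -> Bfield g h n p y = e y *: Kern (g y) n p.
Proof.
move=> Uy; rewrite /Bfield /Bform /Kern /Bform scaler_sumr; apply: eq_bigr => i _.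
by rewrite [RHS]scalerA; congr (_ *: _); exact: mxE.
Qed.

Lemma Bfield_section n p : section_of_Lplus U g (fun y => e y *: Kern (g y) n p).
Proof.
split; first by apply: smooth_scalemx => //; [exact: smooth_conf_factor | exact: smooth_Kern].
by move=> y Uy; apply: LplusZ; [exact: gip | apply: Lplus_Kern; exact: gip].
Qed.

(** The kernel of the conformal metric is e^(4 f) K, which is e^(2 f) B_h.  So B_h
    is its image under the inverse of the transport, and [torsion_Kern] for the
    conformal metric is the claim. *)
Lemma torsion_conf m n p x : U x ->
  d2 (LeviCivita g) (Bfield g h) m n p x
  + bracket12 (g x) (fun m => alpha m x) (Bform (g x) (h x)) m n p = 0.
Proof.
move=> Ux; have e0 : e x != 0 by rewrite gt_eqF ?conf_factor_gt0.
have L k a b : e x *: (LeviCivita g k (Bfield g h a b) x +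
  cross (g x) (alpha k x) (Bform (g x) (h x) a b))
    = LeviCivita gh k (fun y => Kern (gh y) a b) x.
  have -> : LeviCivita gh k (fun y => Kern (gh y) a b) x =
      LeviCivita gh k (fun y => e y *: (e y *: Kern (g y) a b)) x.
    apply: (LeviCivita_eq gh oU k Ux) => y Uy.
    by rewrite (Kern_conf (gip Uy) (conf_factor_gt0 y)) scalerA -expr2.
  rewrite (LeviCivita_conf k (Bfield_section a b) Ux); congr (_ *: (_ + _)).
    by apply: (LeviCivita_eq g oU k Ux) => y Uy; exact: Bfield_conf.
  by rewrite (cross_alpha k _ Ux); congr (_ *: cross _ _ _); exact: Bfield_conf.
apply: (scalerI e0); rewrite scaler0 -(torsion_Kern oU smooth_conf_metric
  inner_product_conf_metric m n p Ux) /d2 -!L.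
by rewrite /d2 /bracket12 -!scalerDr; congr (_ *: _); rewrite addrACA; congr (_ + _);
  rewrite addrACA.
Qed.

Lemma ad_inv_conf m x : U x ->
  ad_inv g h x (fun p q r => d2 (LeviCivita g) (Bfield g h) p q r x) m = - alpha m x.
Proof.
move=> Ux; pose c p q r := d2 (LeviCivita g) (Bfield g h) p q r x.
change (ad_inv g h x c m = - alpha m x); have gx := gip Ux.
pose a : {ffun 'I_4 -> 'M[R]_4} := [ffun k => - alpha k x].
have crossN s t : cross (g x) (- s) t = - cross (g x) s t.
  by rewrite -[- s]scaleN1r crossZl // scaleN1r.
have bN (b : 'I_4 -> 'M[R]_4) k n p : bracket12 (g x) (fun k => - b k) (Bform (g x) (h x)) k n p =
    - bracket12 (g x) b (Bform (g x) (h x)) k n p.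
  by rewrite /bracket12 !crossN !opprD.
have aP : (forall k, Lplus (g x) (a k)) /\
    forall k n p, bracket12 (g x) a (Bform (g x) (h x)) k n p = c k n p.
  split=> [k|k n p]; first by rewrite ffunE -[- _]scaleN1r; apply: LplusZ => //; exact: Lplus_alpha.
  have -> : bracket12 (g x) a (Bform (g x) (h x)) k n p =
      bracket12 (g x) (fun k => - alpha k x) (Bform (g x) (h x)) k n p.
    by rewrite /bracket12 !ffunE.
  rewrite bN /c; apply/eqP; rewrite eq_sym -addr_eq0; apply/eqP.
  exact: torsion_conf.
rewrite /ad_inv; case: xgetP => [b _ [bL bE]|/(_ a)]; last by case.
suff -> : b m = a m by rewrite ffunE.
apply/eqP; rewrite -subr_eq0; apply/eqP.
apply: (torsion_inj gx (a := fun k => b k - a k) (e := e x));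
  first by rewrite gt_eqF ?conf_factor_gt0.
  by move=> k; rewrite -[- a k]scaleN1r; apply: LplusD => //; apply: LplusZ => //; have [] := aP.
move=> k n p; have [_ aE] := aP.
have -> : bracket12 (g x) (fun k => b k - a k) (Bform (g x) (h x)) k n p =
    bracket12 (g x) b (Bform (g x) (h x)) k n p - bracket12 (g x) a (Bform (g x) (h x)) k n p.
  rewrite /bracket12 !crossDl // !crossN !opprD.
  by rewrite (addrACA (cross _ (b k) _)) [LHS]addrACA.
by rewrite bE aE subrr.
Qed.

(** The connection A(h) is the Levi-Civita connection of the conformal metric,
    transported by v |-> e^(2 f) v. *)
Lemma Aconn_conf m v x : section_of_Lplus U g v -> U x ->
  Aconn g h m v x = (e x)^-1 *: LeviCivita gh m (fun y => e y *: v y) x.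
Proof.
move=> Lv Ux; rewrite (LeviCivita_conf m Lv Ux) scalerA mulVf ?gt_eqF ?conf_factor_gt0// scale1r.
by rewrite /Aconn /add_connection (ad_inv_conf m Ux) opprK (cross_alpha m _ Ux).
Qed.

Lemma Aconn_eq m u v x : U x -> (forall y, U y -> u y = v y) ->
  Aconn g h m u x = Aconn g h m v x.
Proof.
move=> Ux uv; rewrite /Aconn /add_connection uv //; congr (_ + _).
exact: (LeviCivita_eq g oU m Ux).
Qed.

Lemma section_conf v : section_of_Lplus U g v -> section_of_Lplus U gh (fun y => e y *: v y).
Proof.
move=> [Sv Lv]; split; first by apply: smooth_scalemx => //; exact: smooth_conf_factor.
move=> y Uy; apply/(Lplus_conf (gip Uy) (conf_factor_gt0 y)).
by apply: LplusZ; [exact: gip | exact: Lv].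
Qed.

Lemma Aconn_section m v : section_of_Lplus U g v ->
  section_of_Lplus U g (fun y => (e y)^-1 *: LeviCivita gh m (fun y => e y *: v y) y).
Proof.
move=> Lv; have [Sev Lev] := section_conf Lv; split.
  apply: smooth_scalemx => //.
    by apply: smooth_inv => //; [move=> y _; exact: conf_factor_gt0 | exact: smooth_conf_factor].
  exact: (LeviCivita_smooth oU smooth_conf_metric inner_product_conf_metric).
move=> y Uy; apply: LplusZ; first exact: gip.
apply/(Lplus_conf (gip Uy) (conf_factor_gt0 y)).
exact: (Lplus_LeviCivita oU smooth_conf_metric inner_product_conf_metric m (section_conf Lv) Uy).
Qed.

Lemma Aconn_commutator m n v x : section_of_Lplus U g v -> U x ->
  Aconn g h m (Aconn g h n v) x - Aconn g h n (Aconn g h m v) x =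
  - (curvature_mx gh m n x)^T *m v x - v x *m curvature_mx gh m n x.
Proof.
move=> Lv Ux; have e0 y : e y != 0 by rewrite gt_eqF ?conf_factor_gt0.
have A2 k l : Aconn g h k (Aconn g h l v) x =
    (e x)^-1 *: LeviCivita gh k (LeviCivita gh l (fun y => e y *: v y)) x.
  rewrite (Aconn_eq k Ux (fun y Uy => Aconn_conf l Lv Uy)) (Aconn_conf k (Aconn_section l Lv) Ux).
  congr (_ *: _); apply: (LeviCivita_eq gh oU k Ux) => y Uy.
  by rewrite scalerA mulfV // scale1r.
have [Sev _] := section_conf Lv.
rewrite !A2 -scalerBr (ricci_identity oU smooth_conf_metric inner_product_conf_metric m n Sev Ux).
rewrite -scalemxAr -scalemxAl -scalerBr scalerA mulVf // scale1r.
by [].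
Qed.

(** The curvature of the conformal metric as an so(4)-valued 2-form: lowering the
    first index makes it skew-symmetric. *)
Definition curv_low m n x : 'M[R]_4 := gh x *m curvature_mx gh m n x.

Lemma curv_low_skew m n x : U x -> (curv_low m n x)^T = - curv_low m n x.
Proof.
move=> Ux; rewrite /curv_low trmx_mul -(curvature_mx_skew oU smooth_conf_metric
  inner_product_conf_metric m n Ux).
by have [-> _] := inner_product_conf_metric Ux.
Qed.

(** By the Ricci identity the curvature acts through so(4), which [cross_skew]
    expresses as a bracket.  The factor e^(-2 f) appears because the bracket
    belongs to g and the index of [curv_low] is lowered by the conformal
    metric. *)
Lemma curvature_conf m n x : U x ->
  curvature U g (Aconn g h) m n x = ((e x)^-1 * Num.sqrt 2) *: proj (g x) (curv_low m n x).
Proof.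
move=> Ux; have gx := gip Ux; set F := _ *: proj _ _.
have LF : Lplus (g x) F by apply: LplusZ => //; exact: Lplus_proj.
have FP v : section_of_Lplus U g v ->
    cross (g x) F (v x) = Aconn g h m (Aconn g h n v) x - Aconn g h n (Aconn g h m v) x.
  move=> Lv; rewrite (Aconn_commutator m n Lv Ux) /F crossZl // cross_proj // -scalerA.
  rewrite (cross_skew gx (curv_low_skew m n Ux)); last by have [_] := Lv; exact.
  have gu := metric_unit gx; have e0 : e x != 0 by rewrite gt_eqF ?conf_factor_gt0.
  have -> : curvature_mx gh m n x = (e x)^-1 *: (invmx (g x) *m curv_low m n x).
    by rewrite /curv_low -scalemxAl -scalemxAr scalerA mulVf // scale1r mulKmx.
  have -> : ((e x)^-1 *: (invmx (g x) *m curv_low m n x))^T =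
    - ((e x)^-1 *: (curv_low m n x *m invmx (g x))).
    by rewrite linearZ /= trmx_mul curv_low_skew // invmetric_tr // mulNmx scalerN.
  by rewrite opprK -scalemxAr -scalemxAl -scalerBr !mulmxA.
rewrite /curvature; case: xgetP => [f' _ [Lf' f'P]|/(_ F)]; last by case.
apply: (cross_inj gx Lf' LF) => v Lv.
(* the defining property only tests smooth sections; those of the kernel span the fibre *)
have K p q : cross (g x) f' (Kern (g x) p q) = cross (g x) F (Kern (g x) p q).
  have LK : section_of_Lplus U g (fun y => Kern (g y) p q).
    split; first exact: smooth_Kern.
    by move=> y Uy; apply: Lplus_Kern; exact: gip.
  by rewrite (f'P _ LK) (FP _ LK).
rewrite (Kern_span gx Lv).
have crossr s I (r : seq I) (G : I -> 'M[R]_4) :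
    cross (g x) s (\sum_(i <- r) G i) = \sum_(i <- r) cross (g x) s (G i).
  apply: (big_morph (cross (g x) s)); first by move=> a b; exact: crossDr.
  by rewrite -[X in cross _ _ X](scale0r 0) crossZr // scale0r.
by rewrite !crossr; apply: eq_bigr => p _; rewrite !crossr; apply: eq_bigr => q _;
  rewrite !crossZr // K.
Qed.

(** Contracting the curvature 2-form with v in the endomorphism slots gives the
    curvature operator of the conformal metric at v, because the powers of
    e^(2 f) coming from h^-1, from the curvature and from the fibre metric
    cancel. *)
Lemma Phi_conf x v : U x -> Lplus (g x) v ->
  Phi_loc U g h x v = Num.sqrt 2 *: proj (gh x)
    (\matrix_(p, q) ip2 (gh x) (curv_low p q x) v) - v.
Proof.
move=> Ux Lv; have gx := gip Ux; have e0 : e x != 0 by rewrite gt_eqF ?conf_factor_gt0.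
rewrite /Phi_loc; congr (_ - _).
have -> : Lplus_inv (g x) (h x) v = (e x)^-1 *: v.
  rewrite /Lplus_inv; case: xgetP => [u _ [Lu uE]|/(_ ((e x)^-1 *: v))].
    by rewrite -uE /h scalerA mulVf // scale1r.
  by case; split; [exact: LplusZ | rewrite /h scalerA mulfV // scale1r].
set F := fun m n => curvature U g (Aconn g h) m n x.
have FE m n : F m n = ((e x)^-1 * Num.sqrt 2) *: proj (g x) (curv_low m n x).
  exact: curvature_conf.
have curvA m n : curv_low n m x = - curv_low m n x by rewrite /curv_low curvature_mx_anti mulmxN.
have M_skew (A : 'M[R]_4) w : (\matrix_(p, q) ip2 A (curv_low p q x) w)^T =
    - \matrix_(p, q) ip2 A (curv_low p q x) w.
  have ip2N s : ip2 A (- s) w = - ip2 A s w.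
    rewrite /ip2 -mulrN; congr (_ * _).
    by do 4!(rewrite -sumrN; apply: eq_bigr => ? _); rewrite mxE; ring.
  by apply/matrixP => p q; rewrite [LHS]mxE [LHS]mxE [RHS]mxE [X in - X]mxE (curvA p q).
rewrite (proj_conf gx (conf_factor_gt0 x)) //.
have ip2_proj s w : Lplus (g x) w -> ip2 (g x) (proj (g x) s) w = ip2 (g x) s w.
  move=> /(LplusP gx) wE; transitivity (ip2 (g x) s (proj (g x) w)); last by rewrite -wE.
  rewrite (ip2C gx) /proj !ip2_sumr //; apply: eq_bigr => i _.
  by rewrite (ip2Zr gx w _ (Sigma (g x) i)) (ip2Zr gx s _ (Sigma (g x) i)) (ip2C gx w) (ip2C gx s)
    mulrC.
have FA p q : F q p = - F p q.
  rewrite !FE curvA /proj -scalerN; congr (_ *: _); rewrite -sumrN; apply: eq_bigr => i _.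
  by rewrite -scaleNr -[- curv_low _ _ _]scaleN1r ip2Zr // mulN1r.
apply/matrixP => m n; rewrite mxE sd_part_skew // [RHS]mxE summxE.
rewrite ip2C // ip2_sumr // mulr_sumr; apply: eq_bigr => i _.
rewrite ip2Zr // ip2Zr // [X in _ = _ * X]mxE [RHS]mulrA [RHS]mulrC; congr (_ * _).
rewrite ip2_sumr // (ip2E gx (Sigma (g x) i)) [RHS]mulrCA; congr (_ * _); rewrite mulr_sumr.
apply: eq_bigr => p _; rewrite ip2_sumr // mulr_sumr; apply: eq_bigr => q _.
rewrite ip2Zr // FE [in RHS]mxE (ip2C gx ((e x)^-1 *: v)) ip2Zr // ip2Zl // ip2_proj //.
rewrite (ip2_conf gx (conf_factor_gt0 x)).
by field.
Qed.
End conformal_change.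

(** * The curvature operator on self-dual forms *)

Section algebraic_curvature.
Variables (R : realType) (G : 'M[R]_4).
Hypothesis Gip : inner_product G.

(** A combination of the four cyclic identities, one for each choice of the fixed index. *)
Lemma pair_symmetry (r : 'I_4 -> 'I_4 -> 'I_4 -> 'I_4 -> R) :
  (forall a b c d, r b a c d = - r a b c d) ->
  (forall a b c d, r a b d c = - r a b c d) ->
  (forall a b c d, r a b c d + r a c d b + r a d b c = 0) ->
  forall a b c d, r a b c d = r c d a b.
Proof.
move=> s1 s2 bi a b c d.
have := bi a b c d; have := bi b c d a; have := bi c d a b; have := bi d a b c.
rewrite (s1 a b c d) (s1 a c b d) (s2 a c d b) (s1 b c d a) (s1 a d b c).
rewrite (s1 b d c a) (s2 b d a c) (s1 c d a b); lra.
Qed.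

Lemma Sigma_clifford i j :
  Sigma G i *m invmx G *m Sigma G j + Sigma G j *m invmx G *m Sigma G i = - (i == j)%:R *: G.
Proof.
rewrite !Sigma_mul // (eq_sym j) addrACA -scalerDr -big_split /= big1 => [|k _].
  by rewrite scaler0 add0r -opprD -scalerDl scaleNr; congr (- (_ *: _)); field.
by rewrite -scalerDl !levi3E [X in X *: _](_ : _ = 0) ?scale0r//; ring.
Qed.

(** A trace-free symmetric rho exchanges self-dual and anti-self-dual forms, so
    only the trace of rho survives the projection. *)
Lemma proj_anticommutator (rho v : 'M[R]_4) : rho^T = rho -> Lplus G v ->
  proj G (v *m invmx G *m rho + rho *m invmx G *m v) = (2^-1 * \tr (invmx G *m rho)) *: v.
Proof.
move=> rhoT Lv.
have vT := Lplus_skew Lv; have giT := invmetric_tr Gip.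
have skew (u : 'M[R]_4) : u^T = - u -> (u *m invmx G *m rho + rho *m invmx G *m u)^T
    = - (u *m invmx G *m rho + rho *m invmx G *m u).
  move=> uT; rewrite [LHS]raddfD /= !trmx_mul uT rhoT giT addrC opprD.
  by rewrite !mulNmx !mulmxN !mulmxA.
have S i j : ip2 G (Sigma G i) (Sigma G j *m invmx G *m rho + rho *m invmx G *m Sigma G j)
    = 2^-1 * \tr (invmx G *m rho) * (i == j)%:R.
  rewrite ip2_skew ?skew ?Sigma_tr// mulmxDl mulmxDl mulmxDl linearD /=.
  have -> : \tr (Sigma G j *m invmx G *m rho *m invmx G *m Sigma G i *m invmx G) =
      \tr (rho *m invmx G *m (Sigma G i *m invmx G *m Sigma G j) *m invmx G).
    transitivity (\tr (Sigma G j *m invmx G *m (rho *m invmx G *m Sigma G i *m invmx G))).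
      by rewrite !mulmxA.
    by rewrite mxtrace_mulC !mulmxA.
  have -> : \tr (rho *m invmx G *m Sigma G j *m invmx G *m Sigma G i *m invmx G) =
      \tr (rho *m invmx G *m (Sigma G j *m invmx G *m Sigma G i) *m invmx G).
    by rewrite !mulmxA.
  rewrite -linearD /= -mulmxDl -mulmxDr Sigma_clifford.
  rewrite -scalemxAr -scalemxAl linearZ /= -mulmxA mulmxV ?metric_unit// mulmx1 mxtrace_mulC.
  by ring.
apply: (Lplus_inj Gip); [exact: Lplus_proj | exact: LplusZ | move=> i].
have lin (x : 'I_3 -> R) (S' : 'I_3 -> 'M[R]_4) :
    (\sum_j x j *: S' j) *m invmx G *m rho + rho *m invmx G *m (\sum_j x j *: S' j) =
    \sum_j x j *: (S' j *m invmx G *m rho + rho *m invmx G *m S' j).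
  rewrite mulmx_sumr !mulmx_suml -big_split; apply: eq_bigr => j _.
  by rewrite /= -!scalemxAl -scalemxAr scalerDr.
rewrite ip2_coord // ip2Zr // {1 2}((LplusP Gip v).1 Lv) lin ip2_sumr //.
rewrite (bigD1 i) //= ip2Zr // S eqxx mulr1 big1 ?addr0 1?mulrC// => j ji.
by rewrite ip2Zr // S eq_sym (negPf ji) !mulr0.
Qed.

(** [Sigma_kernel] with all four indices raised. *)
Lemma sharp_kernel m n p q :
  \sum_i sharp G (Sigma G i) m n * sharp G (Sigma G i) p q =
  2^-1 * (invmx G m p * invmx G n q - invmx G m q * invmx G n p
     + Num.sqrt (\det G) * \det (invmx G) * levi_civita R [tuple m; n; p; q]).
Proof.
transitivity (\sum_a \sum_b \sum_c \sum_d invmx G a m * invmx G b n * invmx G c p * invmx G d q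
   * \sum_i Sigma G i a b * Sigma G i c d).
  under eq_bigr => i _.
    rewrite (sharpE Gip _ m) (sharpE Gip _ p) mulr_suml; over.
  rewrite exchange_big /=; apply: eq_bigr => a _.
  under eq_bigr do rewrite mulr_suml.
  rewrite exchange_big /=; apply: eq_bigr => b _.
  under eq_bigr do rewrite mulr_sumr.
  rewrite exchange_big /=; apply: eq_bigr => c _.
  under eq_bigr do rewrite mulr_sumr.
  rewrite exchange_big /=; apply: eq_bigr => d _.
  by rewrite mulr_sumr; apply: eq_bigr => i _; ring.
rewrite -mulrA -levi_transform.
(* raising the two indices of the metric terms of the kernel *)
have P a b c d : \sum_r \sum_u invmx G r c * invmx G u d * (G a r * G b u) =
  (a == c)%:R * (b == d)%:R.
  rewrite -!(metricV Gip) mulr_suml; apply: eq_bigr => r _; rewrite mulr_sumr.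
  by apply: eq_bigr => u _; ring.
have Q c d : \sum_a \sum_b invmx G a m * invmx G b n * ((a == c)%:R * (b == d)%:R) =
    invmx G m c * invmx G n d.
  rewrite (invmetric_sym Gip m) (invmetric_sym Gip n) -(sum_delta (fun a => invmx G a m) c).
  rewrite mulr_suml; apply: eq_bigr => a _; rewrite -(sum_delta (fun b => invmx G b n) d).
  by rewrite mulr_sumr; apply: eq_bigr => b _; rewrite (eq_sym c) (eq_sym d); ring.
rewrite -(Q p q) -(Q q p) -sumrB mulr_sumr -big_split /= mulr_sumr; apply: eq_bigr => a _.
rewrite -sumrB mulr_sumr -big_split /= mulr_sumr; apply: eq_bigr => b _.
have P' : \sum_r \sum_u invmx G r p * invmx G u q * (G a u * G b r) = (a == q)%:R * (b == p)%:R.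
  by rewrite -P exchange_big /=; apply: eq_bigr => r _; apply: eq_bigr => u _; ring.
rewrite -(P a b p q) -P' !mulr_sumr -sumrB -big_split /= mulr_sumr.
apply: eq_bigr => c _; rewrite !mulr_sumr -sumrB -big_split /= mulr_sumr.
by apply: eq_bigr => d _; rewrite Sigma_kernel //; field.
Qed.
End algebraic_curvature.

Section curvature_operator.
Variables (R : realType) (U : set 'rV[R]_4) (g : 'rV[R]_4 -> 'M[R]_4).
Hypotheses (oU : open U) (Sg : smooth U g) (gip : forall x, U x -> inner_product (g x)).
Variable x : 'rV[R]_4.
Hypothesis Ux : U x.
Let G := g x.
Let gi := invmx G.
Let Gip : inner_product G := gip Ux.

Let Rm q p m n : R := riemann_low g q p m n x.

Lemma riemann_lowE q p m n : riemann_low g q p m n x = (G *m curvature_mx g m n x) q p.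
Proof. by rewrite mxE; apply: eq_bigr => l _; rewrite mxE. Qed.

Lemma Rm_anti_r q p m n : Rm q p n m = - Rm q p m n.
Proof. by rewrite /Rm !riemann_lowE curvature_mx_anti mulmxN mxE. Qed.

Lemma Rm_anti_l q p m n : Rm p q m n = - Rm q p m n.
Proof.
rewrite /Rm !riemann_lowE; have := curvature_mx_skew oU Sg gip m n Ux.
have -> : (curvature_mx g m n x)^T *m g x = (G *m curvature_mx g m n x)^T.
  by rewrite trmx_mul; have [-> _] := Gip.
by move=> /matrixP/(_ q p); rewrite mxE [RHS]mxE.
Qed.

Lemma Rm_bianchi q p m n : Rm q p m n + Rm q m n p + Rm q n p m = 0.
Proof.
rewrite /Rm /riemann_low -!big_split big1 //= => l _; rewrite -!mulrDr.
have := bianchi oU gip m n p l Ux; rewrite !mxE => ->.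
by rewrite mulr0.
Qed.

Lemma Rm_pair_sym q p m n : Rm q p m n = Rm m n q p.
Proof.
apply: pair_symmetry => a b c d; [exact: Rm_anti_l | exact: Rm_anti_r | exact: Rm_bianchi].
Qed.

Let ric : 'M[R]_4 := \matrix_(p, n) ricci g p n x.

Lemma ricciE p n : ricci g p n x = \sum_q \sum_l gi q l * Rm q p l n.
Proof.
rewrite exchange_big /=; apply: eq_bigr => l _.
have -> : riemann g l p l n x = (gi *m (G *m curvature_mx g l n x)) l p.
  by rewrite mulKmx ?metric_unit// mxE.
rewrite mxE; apply: eq_bigr => q _.
by rewrite /gi (invmetric_sym Gip) -riemann_lowE.
Qed.

Lemma ricci_sym : ric^T = ric.
Proof.
apply/matrixP => p n; rewrite !mxE !ricciE exchange_big /=.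
apply: eq_bigr => q _; apply: eq_bigr => l _.
by rewrite Rm_pair_sym /gi (invmetric_sym Gip).
Qed.

Lemma scalar_curvature_tr : scalar_curvature g x = \tr (gi *m ric).
Proof.
apply: eq_bigr => p _; rewrite mxE; apply: eq_bigr => n _.
by congr (_ * _); have /matrixP/(_ n p) := ricci_sym; rewrite !mxE.
Qed.

(** The curvature operator on 2-forms, with the sign that makes it positive on
    round spheres. *)
Let riem_op (v : 'M[R]_4) : 'M[R]_4 := \matrix_(p, q) ip2 G (G *m curvature_mx g p q x) v.

Lemma riem_opE v m n : riem_op v m n = 2^-1 * \sum_p \sum_q sharp G v p q * Rm m n p q.
Proof.
rewrite mxE ip2C // ip2E //; congr (_ * _).
by apply: eq_bigr => p _; apply: eq_bigr => q _; rewrite -riemann_lowE -Rm_pair_sym.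
Qed.

Lemma weyl_opE v : v^T = - v -> weyl_op g x v =
  riem_op v - 2^-1 *: (v *m gi *m ric + ric *m gi *m v) + (scalar_curvature g x / 6) *: v.
Proof.
move=> vT; apply/matrixP => m n.
have sv : g x *m sharp G v *m g x = v.
  by rewrite /sharp !mulmxA mulmxV ?metric_unit// mul1mx mulmxKV ?metric_unit.
have T (A B : 'M[R]_4) : \sum_p \sum_q sharp G v p q * (A m p * B n q) =
  (A *m sharp G v *m B^T) m n.
  rewrite exchange_big [RHS]mxE; apply: eq_bigr => q _.
  by rewrite [(A *m _) _ _]mxE mulr_suml [B^T _ _]mxE; apply: eq_bigr => p _; ring.
have svT : (sharp G v)^T = - sharp G v.
  by rewrite /sharp !trmx_mul vT invmetric_tr // mulNmx mulmxN mulmxA.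
have T' (A B : 'M[R]_4) : \sum_p \sum_q sharp G v p q * (A m q * B n p) =
  - (A *m sharp G v *m B^T) m n.
  rewrite -T exchange_big -sumrN; apply: eq_bigr => p _; rewrite -sumrN.
  apply: eq_bigr => q _; have /matrixP/(_ p q) := svT; rewrite mxE [RHS]mxE => ->.
  by rewrite mulNr.
have GT : G^T = G by have [] := Gip.
have gu := metric_unit Gip.
have t1 : (G *m sharp G v *m ric^T) m n = (v *m gi *m ric) m n.
  by rewrite ricci_sym /sharp !mulmxA mulmxV // mul1mx.
have t2 : (ric *m sharp G v *m G^T) m n = (ric *m gi *m v) m n.
  by rewrite GT /sharp !mulmxA mulmxKV.
have t3 : (G *m sharp G v *m G^T) m n = v m n by rewrite GT sv.
rewrite mxE entryD entryD entryN riem_opE [X in _ = _ - X + _]mxE [X in _ =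
  _ + X]mxE entryD -t1 -t2 -t3 -!T.
have N (A B : 'M[R]_4) : \sum_p \sum_q sharp G v p q * (A m q * B n p) =
    - \sum_p \sum_q sharp G v p q * (A m p * B n q) by rewrite T' T.
transitivity (2^-1 * (\sum_p \sum_q sharp G v p q * Rm m n p q
  - 2^-1 * (\sum_p \sum_q sharp G v p q * (G m p * ric n q)
            - \sum_p \sum_q sharp G v p q * (G m q * ric n p)
            - \sum_p \sum_q sharp G v p q * (ric m q * G n p)
            + \sum_p \sum_q sharp G v p q * (ric m p * G n q))
  + scalar_curvature g x / 6 * (\sum_p \sum_q sharp G v p q * (G m p * G n q)
            - \sum_p \sum_q sharp G v p q * (G m q * G n p)))); last first.
  by rewrite !N; field.
congr (_ * _); rewrite -!sumrB -big_split /= !mulr_sumr -sumrB -big_split /=.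
apply: eq_bigr => p _; rewrite -!sumrB -big_split /= !mulr_sumr -sumrB -big_split /=.
apply: eq_bigr => q _.
transitivity (weyl g m n p q x * sharp G v p q).
  rewrite sharpE // mulr_sumr; apply: eq_bigr => r _; rewrite mulr_sumr.
  by apply: eq_bigr => l _; rewrite (invmetric_sym Gip r) (invmetric_sym Gip l) !mulrA.
by rewrite /weyl ![ric _ _]mxE -/(Rm m n p q) -/G; ring.
Qed.

Lemma riem_op_skew v : (riem_op v)^T = - riem_op v.
Proof.
apply/matrixP => m n; rewrite mxE [RHS]mxE !riem_opE -mulrN; congr (_ * _).
rewrite -sumrN; apply: eq_bigr => p _; rewrite -sumrN; apply: eq_bigr => q _.
by rewrite Rm_anti_l mulrN.
Qed.

Lemma proj_lin a b c (s t u : 'M[R]_4) :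
  proj G (a *: s + b *: t + c *: u) = a *: proj G s + b *: proj G t + c *: proj G u.
Proof.
rewrite /proj !scaler_sumr -!big_split; apply: eq_bigr => i _ /=.
by rewrite !(ip2Dr Gip, ip2Zr Gip (Sigma G i) _ s, ip2Zr Gip (Sigma G i) _ t,
  ip2Zr Gip (Sigma G i) _ u) !scalerDl !scalerA.
Qed.

(** The trace-free Ricci part of the curvature drops out by [proj_anticommutator].
    The trace of the Ricci tensor contributes - s / 4 and the scalar term of the
    Weyl tensor s / 6, together - s / 12. *)
Lemma weyl_plusE v : Lplus G v ->
  weyl_plus g x v = proj G (riem_op v) - (scalar_curvature g x / 12) *: v.
Proof.
move=> Lv; have vT := Lplus_skew Lv; have giT := invmetric_tr Gip.
have kT : (v *m gi *m ric + ric *m gi *m v)^T = - (v *m gi *m ric + ric *m gi *m v).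
  rewrite [LHS]raddfD /= !trmx_mul vT ricci_sym giT addrC opprD.
  by rewrite !mulNmx !mulmxN !mulmxA.
have wT : (weyl_op g x v)^T = - weyl_op g x v.
  rewrite weyl_opE // [LHS]raddfD /= [X in X + _]raddfB /= !linearZ /= riem_op_skew kT vT.
  by rewrite !scalerN !opprD !opprK.
have -> : weyl_plus g x v = proj G (weyl_op g x v).
  by apply/matrixP => m n; rewrite mxE sd_part_proj.
rewrite weyl_opE // -[riem_op v]scale1r -scaleNr proj_lin proj_anticommutator ?ricci_sym//.
rewrite -((LplusP Gip v).1 Lv) scalar_curvature_tr !scale1r -addrA scalerA -scalerDl -scaleNr.
by congr (_ + _ *: _); field.
Qed.

(** By [sharp_kernel] the left-hand side contracts the Riemann tensor with
    g g - g g + vol.  The two metric terms give the scalar curvature, and the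
    volume term vanishes by the first Bianchi identity. *)
Lemma trace_riem_op :
  \sum_i ip2 G (Sigma G i) (riem_op (Sigma G i)) = scalar_curvature g x / 4.
Proof.
have eps0 : \sum_m \sum_n \sum_p \sum_q Rm m n p q * levi_civita R [tuple m; n; p; q] = 0.
  apply: big1 => m _; pose F n p q := Rm m n p q * levi_civita R [tuple m; n; p; q].
  have rot (H : 'I_4 -> 'I_4 -> 'I_4 -> R) :
      \sum_n \sum_p \sum_q H n p q = \sum_n \sum_p \sum_q H p q n.
    rewrite [RHS]exchange_big /=; apply: eq_bigr => n _.
    by rewrite exchange_big /=.
  have F1 : \sum_n \sum_p \sum_q F n p q = \sum_n \sum_p \sum_q F p q n by exact: rot.
  have F2 : \sum_n \sum_p \sum_q F n p q = \sum_n \sum_p \sum_q F q n p.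
    by rewrite F1; exact: rot.
  have F3 : \sum_n \sum_p \sum_q (F n p q + F p q n + F q n p) = 0.
    apply: big1 => n _; apply: big1 => p _; apply: big1 => q _.
    (* the symbol is invariant under cyclic permutations of its last three indices *)
    have -> : F n p q + F p q n + F q n p = (Rm m n p q + Rm m p q n + Rm m q n p)
       * levi_civita R [tuple m; n; p; q] by rewrite /F !levi4E; ring.
    by rewrite Rm_bianchi mul0r.
  have : \sum_n \sum_p \sum_q (F n p q + F p q n + F q n p) = 3 * \sum_n \sum_p \sum_q F n p q.
    transitivity (\sum_n \sum_p \sum_q F n p q + \sum_n \sum_p \sum_q F p q n +
      \sum_n \sum_p \sum_q F q n p).
      rewrite -!big_split; apply: eq_bigr => n _; rewrite -!big_split; apply: eq_bigr => p _.
      by rewrite -!big_split.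
    by rewrite -F1 -F2; ring.
  by rewrite F3 => /esym/eqP; rewrite mulf_eq0 pnatr_eq0 /= => /eqP.
have scal : \sum_m \sum_n \sum_p \sum_q Rm m n p q * (gi m p * gi n q) = scalar_curvature g x.
  rewrite /scalar_curvature.
  transitivity (\sum_p \sum_n \sum_q \sum_l Rm q p l n * (gi q l * gi p n)); last first.
    apply: eq_bigr => p _; apply: eq_bigr => n _; rewrite ricciE mulr_sumr.
    apply: eq_bigr => q _; rewrite mulr_sumr; apply: eq_bigr => l _; rewrite -/G -/gi; ring.
  rewrite exchange_big /=; apply: eq_bigr => p _.
  rewrite [RHS]exchange_big /=; apply: eq_bigr => q _.
  exact: exchange_big.
have scal' : \sum_m \sum_n \sum_p \sum_q Rm m n p q * (gi m q * gi n p) = - scalar_curvature g x.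
  rewrite -scal -sumrN; apply: eq_bigr => m _; rewrite -sumrN; apply: eq_bigr => n _.
  rewrite exchange_big -sumrN; apply: eq_bigr => p _; rewrite -sumrN; apply: eq_bigr => q _.
  by rewrite Rm_anti_r mulNr.
pose k := Num.sqrt (\det G) * \det gi.
transitivity (4^-1 * \sum_m \sum_n \sum_p \sum_q Rm m n p q *
    \sum_i sharp G (Sigma G i) m n * sharp G (Sigma G i) p q).
  rewrite mulr_sumr; under eq_bigr => i _ do rewrite ip2E // mulr_sumr.
  rewrite exchange_big /=; apply: eq_bigr => m _.
  rewrite mulr_sumr; under eq_bigr => i _ do rewrite mulr_sumr.
  rewrite exchange_big /=; apply: eq_bigr => n _.
  transitivity (\sum_i \sum_p \sum_q 4^-1 * (Rm m n p q *
     (sharp G (Sigma G i) m n * sharp G (Sigma G i) p q))).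
    apply: eq_bigr => i _; rewrite riem_opE !mulr_sumr; apply: eq_bigr => p _.
    by rewrite !mulr_sumr; apply: eq_bigr => q _; field.
  rewrite exchange_big mulr_sumr /=; apply: eq_bigr => p _.
  rewrite exchange_big mulr_sumr /=; apply: eq_bigr => q _.
  by rewrite !mulr_sumr.
transitivity (4^-1 * (2^-1 * (\sum_m \sum_n \sum_p \sum_q Rm m n p q * (gi m p * gi n q)
   - \sum_m \sum_n \sum_p \sum_q Rm m n p q * (gi m q * gi n p)
   + k * \sum_m \sum_n \sum_p \sum_q Rm m n p q * levi_civita R [tuple m; n; p; q]))); last first.
  by rewrite scal scal' eps0; field.
congr (_ * _).
rewrite -sumrB mulr_sumr -big_split /= mulr_sumr; apply: eq_bigr => m _.
rewrite -sumrB mulr_sumr -big_split /= mulr_sumr; apply: eq_bigr => n _.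
rewrite -sumrB mulr_sumr -big_split /= mulr_sumr; apply: eq_bigr => p _.
rewrite -sumrB mulr_sumr -big_split /= mulr_sumr; apply: eq_bigr => q _.
by rewrite sharp_kernel // -/gi -/k; ring.
Qed.

(** The self-dual block is W^+ + s / 12 with W^+ trace-free.  The equation makes
    its trace s / 4 equal to 3 / sqrt 2, which is s = 6 sqrt 2, and leaves
    W^+ = 0. *)
Lemma asd_scalar_iff :
  (forall v, Lplus G v -> Num.sqrt 2 *: proj G (riem_op v) - v = 0) <->
  ((forall v, Lplus G v -> weyl_plus g x v = 0) /\ scalar_curvature g x = 6 * Num.sqrt 2).
Proof.
have s2 : Num.sqrt 2 != 0 :> R by exact: sqrt2_neq0.
have s22 : Num.sqrt 2 * Num.sqrt 2 = 2 :> R by exact: sqrt2M.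
split=> [H|[W S] v Lv].
  have P v : Lplus G v -> proj G (riem_op v) = (Num.sqrt 2)^-1 *: v.
    move=> /H /eqP; rewrite subr_eq0 => /eqP {2}<-.
    by rewrite scalerA mulVf // scale1r.
  have S : scalar_curvature g x = 6 * Num.sqrt 2.
    have E i : ip2 G (Sigma G i) (riem_op (Sigma G i)) = (Num.sqrt 2)^-1.
      transitivity (ip2 G (Sigma G i) (proj G (riem_op (Sigma G i)))).
        by rewrite /proj (ip2_coord Gip (fun j => ip2 G (Sigma G j) (riem_op (Sigma G i))) i).
      rewrite (P _ (Lplus_Sigma Gip i)) (ip2Zr Gip (Sigma G i) _ (Sigma G i)) ip2_Sigma //.
      by rewrite eqxx mulr1.
    have := trace_riem_op; rewrite (eq_bigr (fun=> (Num.sqrt 2)^-1)) => [|i _]; last exact: E.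
    rewrite sumr_const card_ord; move: (scalar_curvature g x) => s H3.
    have -> : s = 4 * ((Num.sqrt 2)^-1 *+ 3) by rewrite H3; field.
    by apply: (mulfI s2); rewrite mulrCA mulrnAr mulfV// mulrCA s22; ring.
  split=> // v Lv; rewrite weyl_plusE // P // -scalerBl.
  have -> : (Num.sqrt 2)^-1 - scalar_curvature g x / 12 = 0 :> R; last exact: scale0r.
  by apply: (mulfI s2); rewrite S mulrBr mulfV // mulr0 mulrA mulrCA s22; field.
have := W v Lv; rewrite weyl_plusE // => /eqP; rewrite subr_eq0 => /eqP ->.
rewrite S scalerA mulrA mulrCA s22 -[6 * 2]natrM divff ?pnatr_eq0// scale1r subrr.
by [].
Qed.
End curvature_operator.

(** * The equation for a conformal factor *)

Theorem proposition2p21 (R : realType) (M : topologicalType)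
    (A : oriented_atlas R M) (g : tensor2 A) (w : M -> R) :
  hausdorff_space M -> compact [set: M] -> connected [set: M] ->
  riemannian_metric g -> smooth_function A w ->
  vanishes_on_Lplus g (Phi g (conformal_endo w)) <->
  (anti_self_dual (conformal_metric w g) /\
   has_constant_scalar_curvature (conformal_metric w g) (6 * Num.sqrt 2)).
Proof.
move=> _ _ _ gR wS.
have gip c x : img c x -> inner_product (g c x).
  by move=> cx; case: gR => _ /(_ c x cx) gT /(_ c x cx) gpos _; split.
have oU c := @img_open _ _ A c; have gS c := metric_smooth gR c.
have local c x : img c x ->
    (forall v, Lplus (g c x) v -> Phi g (conformal_endo w) c x v = 0) <->
    ((forall v, Lplus (conformal_metric w g c x) v -> weyl_plus (conformal_metric w g c) x v = 0) /\
     scalar_curvature (conformal_metric w g c) x = 6 * Num.sqrt 2).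
  move=> cx; have gc := gip c; have fS := wS c.
  have ghp y : img c y -> inner_product (conformal_metric w g c y).
    by move=> cy; exact: inner_product_conf (gc y cy) (expR_gt0 _).
  have ghs : smooth (img c) (conformal_metric w g c) by exact: smooth_conf_metric (gS c) fS.
  have AE := asd_scalar_iff (oU c) ghs ghp cx.
  apply: (iff_trans _ AE).
  split=> H v Lv.
    have Lv' : Lplus (g c x) v := (Lplus_conf (gip _ _ cx) (expR_gt0 _) v).1 Lv.
    by rewrite -[RHS](H v Lv'); symmetry; exact: (Phi_conf (oU c) (gS c) gc fS cx Lv').
  rewrite -[RHS](H v ((Lplus_conf (gip _ _ cx) (expR_gt0 _) v).2 Lv)).
  exact: (Phi_conf (oU c) (gS c) gc fS cx Lv).
split=> [H|[HW HS] c x cx].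
  by split=> c x cx; have [] := (local c x cx).1 (H c x cx).
by apply: (local c x cx).2; split; [exact: HW | exact: HS].
Qed.
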